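(* Let $(K,\delta)$ be a differential field (of arbitrary characteristic). The following are equivalent: (1) $(K,\delta)$ is separably differentially closed; (2) for any nonzero $f,g\in K\{x\}$ with $f\notin K$, $s_f\neq 0$, and such that no variable $x_j$ with $j\geq \operatorname{ord} f$ occurs in $g$ (i.e. $\operatorname{ord} g<\operatorname{ord} f$), there exists $a\in K$ such that $f(a)=0$ and $g(a)\neq 0$.
   Context: A differential field $(K,\delta)$ is a field with a derivation $\delta$. The differential polynomial ring $K\{x\}=K[x_0,x_1,x_2,\dots]$ (with $x_j$ standing for $\delta^j x$) carries the derivation extending $\delta$ with $\delta(x_j)=x_{j+1}$. For $f\in K\{x\}\setminus K$, $\operatorname{ord} f$ is the largest $n$ such that $x_n$ occurs in $f$, and the separant is $s_f=\partial f/\partial x_{\operatorname{ord} f}$. A field extension $L/K$ is separable if (in characteristic $p>0$) $K$ and $L^p$ are linearly disjoint over $K^p$ (every extension is separable in characteristic $0$). A differential field $(K,\delta)$ is separably differentially closed if for every differential field extension $(L,\delta)$ with $L/K$ separable as a field extension, $(K,\delta)$ is existentially closed in $(L,\delta)$ in the language of differential fields $\{0,1,+,-,\cdot,{}^{-1},\delta\}$ (i.e. every quantifier-free formula with parameters from $K$ which has a solution in $L$ has a solution in $K$). *)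

(* Defs.v *)
From HB Require Import structures.
From mathcomp Require Import all_boot all_order all_algebra finmap.
From mathcomp Require Import monalg.

Set Implicit Arguments.
Unset Strict Implicit.
Unset Printing Implicit Defensive.

Import GRing.Theory.
Local Open Scope ring_scope.

Definition is_derivation (R : nzRingType) (d : R -> R) : Prop :=
  (forall x y : R, d (x + y) = d x + d y) /\
  (forall x y : R, d (x * y) = d x * y + x * d y).

(* K{x} = K[x_0, x_1, ...]: the monomial m stands for
   \prod_j x_j ^+ (m j), the x_j being indexed by j : nat. *)
Definition dpoly (K : fieldType) := {malg K[{cmonom nat}]}.

(* f(a), obtained by substituting d^j(a) for x_j. *)
Definition deval (K : fieldType) (d : K -> K) (f : dpoly K) (a : K) : K :=
  mmap idfun
    (fun m : {cmonom nat} => \prod_(j <- finsupp m) (iter j d a) ^+ m j) f.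

Definition in_base (K : fieldType) (f : dpoly K) : Prop :=
  exists c : K, f = malgC c.

Definition doccurs (K : fieldType) (j : nat) (f : dpoly K) : bool :=
  has (fun m : {cmonom nat} => (0 < m j)%N) (msupp f).

(* The order is meaningful for f not in K only; it is then characterised by
   dordP below. *)
Definition dord (K : fieldType) (f : dpoly K) : nat :=
  (\max_(m <- msupp f) \max_(j <- finsupp (m : {cmonom nat})) j)%N.

Definition dpartial (K : fieldType) (j : nat) (f : dpoly K) : dpoly K :=
  \sum_(m <- msupp f)
     mkmalgU (divcm (m : {cmonom nat}) (ucm j)) (mcoeff m f *+ m j).

Definition separant (K : fieldType) (f : dpoly K) : dpoly K :=
  dpartial (dord f) f.

Lemma doccurs_le_dord (K : fieldType) (f : dpoly K) (j : nat) :
  doccurs j f -> (j <= dord f)%N.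
Proof.
case/hasP=> m mf mj.
have jm : j \in finsupp (m : {cmonom nat}) by rewrite mem_finsupp -lt0n.
rewrite /dord (big_rem m) //= leq_max; apply/orP; left.
by rewrite (big_rem j) //= leq_maxl.
Qed.

Lemma dordP (K : fieldType) (f : dpoly K) :
  ~ in_base f ->
  doccurs (dord f) f /\ forall j, doccurs j f -> (j <= dord f)%N.
Proof.
move=> nf; split; last exact: doccurs_le_dord.
have [m mf m1] : exists2 m, m \in msupp f & m != mone.
  apply/hasP; apply: contra_notT nf => /hasPn h.
  exists (mcoeff mone f); rewrite {1}[f]monalgE.
  have [i|i] := boolP (mone \in msupp f).
    rewrite (big_fsetD1 mone) //= big_seq big1 ?addr0 // => m.
    by rewrite in_fsetD1 => /andP[mN /h]; rewrite (negPf mN).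
  rewrite mcoeff_outdom // monalgU0 big_seq big1 // => m mf.
  by move: (h m mf) i; rewrite negbK => /eqP <-; rewrite mf.
have [j mj] : exists j, (0 < (m : {cmonom nat}) j)%N.
  have : has (fun j => 0 < (m : {cmonom nat}) j)%N (finsupp (m : {cmonom nat})).
    apply: contra_neqT m1 => /hasPn h; apply/eqP/cmP => j.
    have [/h|/fsfun_dflt ->] := boolP (j \in finsupp (m : {cmonom nat})).
      by rewrite -leqNgt leqn0 => /eqP ->; rewrite cm1.
    by rewrite cm1.
  by case/hasP => j _ ?; exists j.
pose s := flatten [seq (finsupp (m : {cmonom nat}) : seq nat) | m <- msupp f].
have -> : dord f = (\max_(j <- s) j)%N.
  by rewrite /s big_flatten big_map.
have js : j \in s.
  by apply/flatten_mapP; exists m; rewrite // mem_finsupp -lt0n.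
have : (\max_(j <- s) j)%N \in s.
  case: s js => // a s _; rewrite -[_ :: _]/(a :: s).
  elim: s a => [|b s IH] a; first by rewrite big_seq1 inE.
  rewrite big_cons; case: (leqP a (\max_(j <- b :: s) j)%N) => _.
    by rewrite inE IH orbT.
  by rewrite inE eqxx.
case/flatten_mapP => m' m'f; rewrite mem_finsupp -lt0n => pos.
by apply/hasP; exists m'.
Qed.

Definition linearly_independent_over (L : fieldType) (C : L -> Prop)
    (n : nat) (v : 'I_n -> L) : Prop :=
  forall c : 'I_n -> L, (forall i, C (c i)) ->
    \sum_i c i * v i = 0 -> forall i, c i = 0.

(* For subfields A and B of L containing the subfield C. *)
Definition linearly_disjoint (L : fieldType) (A B C : L -> Prop) : Prop :=
  forall (n : nat) (v : 'I_n -> L), (forall i, A (v i)) ->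
    linearly_independent_over C v -> linearly_independent_over B v.

(* A field extension L/K is given by its embedding iota : K -> L, and K is
   identified with its image. The condition is vacuous in characteristic 0. *)
Definition separable_ext (K L : fieldType) (iota : {rmorphism K -> L}) : Prop :=
  forall p : nat, p \in [pchar K] ->
    linearly_disjoint
      (fun z : L => exists x : K, z = iota x)
      (fun z : L => exists y : L, z = y ^+ p)
      (fun z : L => exists x : K, z = iota x ^+ p).

(* Terms and quantifier-free formulas of {0, 1, +, -, *, ^-1, delta} with
   parameters in K; the variables are indexed by nat. *)
Inductive dterm (K : Type) : Type :=
  | TVar of nat
  | TParam of K
  | TZero
  | TOne
  | TAdd of dterm K & dterm K
  | TOpp of dterm K
  | TMul of dterm K & dterm K
  | TInv of dterm K
  | TDer of dterm K.

Inductive qfformula (K : Type) : Type :=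
  | FTrue
  | FFalse
  | FEq of dterm K & dterm K
  | FNot of qfformula K
  | FAnd of qfformula K & qfformula K
  | FOr of qfformula K & qfformula K.

(* Interpretation in (L, d), the parameters being sent to L by h. The inverse
   is total, with 0^-1 = 0. *)
Fixpoint teval (K : Type) (L : fieldType) (d : L -> L) (h : K -> L)
    (e : nat -> L) (t : dterm K) : L :=
  match t with
  | TVar i => e i
  | TParam c => h c
  | TZero => 0
  | TOne => 1
  | TAdd t1 t2 => teval d h e t1 + teval d h e t2
  | TOpp t1 => - teval d h e t1
  | TMul t1 t2 => teval d h e t1 * teval d h e t2
  | TInv t1 => (teval d h e t1)^-1
  | TDer t1 => d (teval d h e t1)
  end.

Fixpoint qfholds (K : Type) (L : fieldType) (d : L -> L) (h : K -> L)
    (e : nat -> L) (phi : qfformula K) : Prop :=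
  match phi with
  | FTrue => True
  | FFalse => False
  | FEq t1 t2 => teval d h e t1 = teval d h e t2
  | FNot phi1 => ~ qfholds d h e phi1
  | FAnd phi1 phi2 => qfholds d h e phi1 /\ qfholds d h e phi2
  | FOr phi1 phi2 => qfholds d h e phi1 \/ qfholds d h e phi2
  end.

Definition existentially_closed_in (K : fieldType) (dK : K -> K)
    (L : fieldType) (dL : L -> L) (iota : {rmorphism K -> L}) : Prop :=
  forall phi : qfformula K,
    (exists e : nat -> L, qfholds dL iota e phi) ->
    exists e : nat -> K, qfholds dK idfun e phi.

Definition separably_diff_closed (K : fieldType) (dK : K -> K) : Prop :=
  forall (L : fieldType) (dL : L -> L) (iota : {rmorphism K -> L}),
    is_derivation dL ->
    (forall x : K, iota (dK x) = dL (iota x)) ->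
    separable_ext iota ->
    existentially_closed_in dK dL iota.

(* Main.v *)
Require Import Defs.
From HB Require Import structures.
From mathcomp Require Import all_boot all_order all_algebra all_field finmap.
From mathcomp Require Import generic_quotient monalg ring zify.
From Stdlib Require Import ClassicalEpsilon.

(** (2) => (1).  Let [phi] have a solution in a separable extension [L]. The
    values of the subterms of [phi] generate a finitely generated field [E] over
    [K]; composing the derivation of [L] with an [E]-linear retraction [L -> E]
    gives a derivation [D] of [E] with the same values on the subterms of [phi].
    Choose [u_1, ..., u_e] in [E] and a dual basis [Delta_i] of the [K]-derivations
    of [E]. For sufficiently general [w_k] in [K] the element [a = sum w_k u_k]
    satisfies [det (Delta_i (D^m a)) <> 0]; such [w_k] are combinations, with
    constant coefficients, of elements of [K] with nonzero Wronskian, and (2)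
    provides both. Then [a, ..., D^(e-1) a] are algebraically independent over [K]
    (this is where separability of [L / K] enters, as in Mac Lane's criterion), and
    [E] is separably algebraic over the field they generate. The minimal polynomial
    of [D^e a] is a differential polynomial [f] of order [e] with nonzero separant,
    and a zero [alpha] of [f] in [K] outside the zeros of a suitable [g] of order
    [< e] defines a specialization [D^m a |-> delta^m alpha] which extends, [K] being
    separably closed, to the finitely many elements of [E] that matter. It commutes
    with the derivations because derivations extend uniquely to separable algebraic
    extensions.

    (1) => (2).  Let [n = ord f]. Over [F = K(x_0, ..., x_(n-1))] the polynomial [f]
    in [x_n] has an irreducible factor with nonzero derivative; adjoin a root
    [theta] of it. The derivation with [x_i |-> x_(i+1)] and [x_(n-1) |-> theta]
    extends to [F(theta)], which is separable over [K], and there [x_0] (or [theta]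
    if [n = 0]) is a zero of [f] and not of [g]. *)

Set Implicit Arguments.
Unset Strict Implicit.
Unset Printing Implicit Defensive.

Import GRing.Theory.
Local Open Scope ring_scope.

(** * Subrings and subfields as types *)

(** Excluded middle as a boolean, so that an arbitrary property of field elements can cut out a
    subtype. *)
Definition decb (P : Prop) : bool :=
  if excluded_middle_informative P then true else false.

Lemma decbP (P : Prop) : reflect P (decb P).
Proof. by rewrite /decb; case: excluded_middle_informative => h; constructor. Qed.

Lemma ex_minP (P : nat -> Prop) : (exists n, P n) ->
  exists2 n, P n & forall m, P m -> (n <= m)%N.
Proof.
move=> [n Pn]; have ex : exists n, decb (P n) by exists n; apply/decbP.
case: (ex_minnP ex) => m /decbP Pm min; exists m => // k Pk.
by apply: min; apply/decbP.
Qed.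

Record subring_prop (E : fieldType) (P : E -> Prop) : Prop := SubringProp {
  subring1 : P 1;
  subringB : forall x y, P x -> P y -> P (x - y);
  subringM : forall x y, P x -> P y -> P (x * y) }.

Section SubDomain.
Variables (E : fieldType) (P : E -> Prop) (h : subring_prop P).

Definition subring_pred of subring_prop P := [pred x | decb (P x)].
Local Notation S := (subring_pred h).

Fact subring_pred_closed : GRing.subring_closed S.
Proof.
case: h => P1 PB PM; split; rewrite ?inE; first exact/decbP.
  by move=> x y; rewrite !inE => /decbP Px /decbP Py; apply/decbP/PB.
by move=> x y; rewrite !inE => /decbP Px /decbP Py; apply/decbP/PM.
Qed.
HB.instance Definition _ := GRing.isSubringClosed.Build E S subring_pred_closed.

Inductive subdom := SubDom x & x \in S.
Definition subdom_val u := let: SubDom x _ := u in x.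
HB.instance Definition _ := [isSub for subdom_val].
HB.instance Definition _ := [Choice of subdom by <:].
HB.instance Definition _ := [SubChoice_isSubComNzRing of subdom by <:].

(** Invertibility is tested inside the subring and the inverse is chosen classically, since the
    inverse taken in [E] may lie outside. Non-units are fixed, as the unit ring interface
    requires. *)
Definition subdom_unit := [pred x : subdom | decb (exists y, y * x = 1)].
Definition subdom_inv (x : subdom) : subdom :=
  if decb (exists y, y * x = 1)
  then epsilon (inhabits 0) (fun y => y * x = 1) else x.

Fact subdom_mulVx : {in subdom_unit, left_inverse 1 subdom_inv *%R}.
Proof.
move=> x; rewrite inE /subdom_inv => xu; rewrite xu.
exact: (epsilon_spec (inhabits 0) (fun y => y * x = 1)) (decbP _ xu).
Qed.
Fact subdom_unitPl (x y : subdom) : y * x = 1 -> subdom_unit x.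
Proof. by move=> yx; apply/decbP; exists y. Qed.
Fact subdom_inv_out : {in [predC subdom_unit], subdom_inv =1 id}.
Proof. by move=> x; rewrite !inE /subdom_inv => /negPf ->. Qed.
HB.instance Definition _ := GRing.ComNzRing_hasMulInverse.Build subdom
  subdom_mulVx subdom_unitPl subdom_inv_out.

Fact subdom_integral : GRing.integral_domain_axiom subdom.
Proof.
move=> x y /(congr1 val); rewrite rmorphM rmorph0 => /eqP.
by rewrite mulf_eq0 -!(inj_eq val_inj) rmorph0.
Qed.
HB.instance Definition _ :=
  GRing.ComUnitRing_isIntegral.Build subdom subdom_integral.

Hypothesis subringV : forall x, P x -> P x^-1.
(** A copy of [subdom] indexed by the closure under inversion, so that the field structure attaches
    to this case only. *)
Definition subfld of (forall x, P x -> P x^-1) := subdom.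
HB.instance Definition _ := GRing.IntegralDomain.on (subfld subringV).

Fact subfld_field : GRing.field_axiom (subfld subringV).
Proof.
move=> x x0; apply/unitrP; pose y : subdom := x.
have xS : (val y)^-1 \in S.
  by apply/decbP/subringV/decbP; exact: (valP y).
have x0' : val y != 0 by apply: contra_neq x0 => xe; apply: (val_inj : injective subdom_val).
exists (SubDom xS); split; apply: (val_inj : injective subdom_val).
  by rewrite [LHS](mulVf x0').
by rewrite [LHS](mulfV x0').
Qed.
HB.instance Definition _ :=
  GRing.UnitRing_isField.Build (subfld subringV) subfld_field.
End SubDomain.

(** Hides the construction above: later arguments see a subring only as a domain with an
    embedding. *)
Lemma subring_pack (E : fieldType) (P : E -> Prop) : subring_prop P ->
  exists (A : idomainType) (j : {rmorphism A -> E}),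
    injective j /\ forall x, P x <-> exists a, x = j a.
Proof.
move=> h; exists (subdom h : idomainType), (val : {rmorphism subdom h -> E}).
split=> [|x]; first exact: val_inj.
split=> [Px|[a ->]]; last by apply/decbP; exact: (valP a).
have xS : x \in subring_pred h by apply/decbP.
by exists (SubDom xS).
Qed.

Lemma subfield_pack (E : fieldType) (P : E -> Prop) : subring_prop P ->
  (forall x, P x -> P x^-1) ->
  exists (A : fieldType) (j : {rmorphism A -> E}),
    forall x, P x <-> exists a, x = j a.
Proof.
move=> h hV; exists (subfld h hV : fieldType), (val : {rmorphism subdom h -> E}).
move=> x; split=> [Px|[a ->]]; last by apply/decbP; exact: (valP a).
have xS : x \in subring_pred h by apply/decbP.
by exists (SubDom xS).
Qed.

(** * Differential polynomials *)

Section MonomEval.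
Variables (R : comNzRingType) (z : nat -> R).

Definition monev (m : {cmonom nat}) : R := \prod_(j <- finsupp m) z j ^+ m j.

Lemma monevEw (d : {fset nat}) (m : {cmonom nat}) :
  (finsupp m `<=` d)%fset -> monev m = \prod_(j <- d) z j ^+ m j.
Proof.
move=> sd; apply: big_fset_incl => // j _ /fsfun_dflt mj.
by rewrite mj expr0.
Qed.

Fact monev_mmorphism : mmorphism monev.
Proof.
split=> [m1 m2|]; last by rewrite /monev mdom1 big_seq_fset0.
have s1 : (finsupp m1 `<=` finsupp (mmul m1 m2))%fset by rewrite mdomD fsubsetUl.
have s2 : (finsupp m2 `<=` finsupp (mmul m1 m2))%fset by rewrite mdomD fsubsetUr.
rewrite (monevEw s1) (monevEw s2) -big_split /=; apply: eq_bigr => j _.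
by rewrite cmM exprD.
Qed.
HB.instance Definition _ := isMultiplicative.Build _ _ monev monev_mmorphism.

Lemma monevM m1 m2 : monev (mmul m1 m2) = monev m1 * monev m2.
Proof. exact: (mmorphM monev). Qed.

Lemma monev1 : monev mone = 1.
Proof. exact: (mmorph1 monev). Qed.

Lemma monevU j : monev (ucm j) = z j.
Proof. by rewrite /monev mdomU big_seq_fset1 cmUU. Qed.
End MonomEval.

Lemma mdegS (m : {cmonom nat}) : m != mone ->
  exists2 j, (0 < m j)%N & m = mmul (divcm m (ucm j)) (ucm j).
Proof.
move=> m1; have [j mj] : exists j, j \in finsupp m.
  by apply/fset0Pn; apply: contra_neq m1 => m0; apply/mdeg_eq0I; rewrite mdegE m0 big_seq_fset0.
have mj0 : (0 < m j)%N by rewrite lt0n cmE_neq0.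
exists j => //; apply/eqP/cmP => i; rewrite cmM divcmE cmU.
by case: eqP => [<-|_]; rewrite ?subnK ?subn0 ?addn0.
Qed.

HB.instance Definition _ (K : fieldType) := GRing.ComNzRing.on (dpoly K).

Section Leibniz.
Variables (R : comNzRingType) (d : R -> R).
Hypothesis dD : {morph d : x y / x + y}.
Let leibniz x y := d (x * y) = d x * y + x * d y.

(** Additivity in each factor reduces a product rule to additive generators, in practice to
    monomials. *)
Lemma leibnizDl x1 x2 y : leibniz x1 y -> leibniz x2 y -> leibniz (x1 + x2) y.
Proof. by rewrite /leibniz mulrDl !dD => -> ->; rewrite !mulrDl addrACA. Qed.

Lemma leibnizDr x y1 y2 : leibniz x y1 -> leibniz x y2 -> leibniz x (y1 + y2).
Proof. by rewrite /leibniz mulrDr !dD => -> ->; rewrite !mulrDr addrACA. Qed.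
End Leibniz.

Section DPoly.
Variable K : fieldType.
Implicit Types (P Q : dpoly K) (m : {cmonom nat}).

Definition dX j : dpoly K := mkmalgU (ucm j) 1.

Lemma mul_monom (c c' : K) m m' :
  mkmalgU m c * mkmalgU m' c' = mkmalgU (mmul m m') (c * c') :> dpoly K.
Proof. by rewrite malgM_def fgmulUU. Qed.

Lemma monomE (c : K) m : mkmalgU m c = malgC c * monev dX m :> dpoly K.
Proof.
have -> : mkmalgU m c = malgC c * mkmalgU m 1 :> dpoly K.
  by rewrite mul_monom [c * 1]mulr1 mul1m.
congr (_ * _); move: {2}(mdeg m).+1 (ltnSn (mdeg m)) => n.
elim: n m => // n IH m; have [->|/mdegS[j mj em]] := eqVneq m mone.
  by rewrite monev1.
rewrite em mdegM mdegU addn1 ltnS => lt.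
by rewrite monevM monevU -IH // mul_monom [1 * 1]mulr1.
Qed.

(** The last case is limited to variables of [P], so that facts known only for small indices
    suffice. *)
Lemma dpoly_ind_occ (G : dpoly K -> Prop) P :
  (forall c, G (malgC c)) -> (forall P Q, G P -> G Q -> G (P + Q)) ->
  (forall P Q, G P -> G Q -> G (P * Q)) ->
  (forall j, doccurs j P -> G (dX j)) -> G P.
Proof.
move=> GC GD GM GX; rewrite (monalgE P) big_seq.
have G0 : G 0 by rewrite -malgC0E.
have G1 : G 1 by exact: GC.
apply: (big_ind G); [exact: G0|exact: GD|move=> m mP].
rewrite monomE; apply: (GM); first exact: GC.
rewrite /monev big_seq; apply: (big_ind G); [exact: (G1)|exact: (GM)|move=> j]; rewrite mem_finsupp -lt0n => mj.
have : G (dX j) by apply: GX; apply/hasP; exists m.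
move=> GXj; elim: (m j) => [|n Gn]; first by rewrite expr0; exact: G1.
by rewrite exprS; apply: (GM); [exact: GXj|exact: Gn].
Qed.

Lemma dpoly_ind (G : dpoly K -> Prop) :
  (forall c, G (malgC c)) -> (forall P Q, G P -> G Q -> G (P + Q)) ->
  (forall P Q, G P -> G Q -> G (P * Q)) ->
  (forall j, G (dX j)) -> forall P, G P.
Proof. by move=> GC GD GM GX P; apply: dpoly_ind_occ. Qed.

Lemma doccursD j P Q : doccurs j (P + Q) -> doccurs j P || doccurs j Q.
Proof.
case/hasP=> m /(fsubsetP (msuppD_le _ _)); rewrite in_fsetU.
by case/orP=> mS mj; apply/orP; [left|right]; apply/hasP; exists m.
Qed.

Lemma doccursM j P Q : doccurs j (P * Q) -> doccurs j P || doccurs j Q.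
Proof.
case/hasP=> m /msuppM_le [m1 [m2 [mP mQ ->]]]; rewrite cmM addn_gt0.
by case/orP=> mj; apply/orP; [left; apply/hasP; exists m1|right; apply/hasP; exists m2].
Qed.

Lemma doccursC j c : doccurs j (malgC c : dpoly K) = false.
Proof.
apply/hasP => -[m /(fsubsetP msuppU_le)]; rewrite in_fset1 => /eqP ->.
by rewrite cm1.
Qed.

Lemma doccursX i j : doccurs j (dX i) = (i == j).
Proof.
apply/hasP/idP => [[m]|/eqP <-].
  by rewrite msuppU1 in_fset1 => /eqP ->; rewrite cmU lt0b.
by exists (ucm i); rewrite ?msuppU1 ?in_fset1 // cmUU.
Qed.
End DPoly.
Arguments dX {K} j.

(* Locked, since failing unifications that unfold [mmap] do not terminate in
   reasonable time. *)
HB.lock Definition pev (K : fieldType) (R : comNzRingType)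
    (iota : {rmorphism K -> R}) (z : nat -> R) (P : dpoly K) : R :=
  mmap iota (monev z) P.

(** * Evaluation of differential polynomials *)

Section Eval.
Variables (K : fieldType) (R : comNzRingType) (iota : {rmorphism K -> R}).
Variable z : nat -> R.
Implicit Types (P Q : dpoly K).

Local Notation pev := (pev iota z).

Fact pev_zmod : zmod_morphism pev.
Proof. by rewrite unlock; exact: (raddfB (mmap iota (monev z))). Qed.
HB.instance Definition _ := GRing.isZmodMorphism.Build (dpoly K) R pev pev_zmod.
Fact pev_monoid : monoid_morphism pev.
Proof.
rewrite unlock; split; first exact: (rmorph1 (mmap iota (monev z))).
exact: (rmorphM (mmap iota (monev z))).
Qed.
HB.instance Definition _ := GRing.isMonoidMorphism.Build (dpoly K) R pev pev_monoid.

Lemma pevU c m : pev (mkmalgU m c) = iota c * monev z m.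
Proof. by rewrite unlock; exact: mmapU. Qed.

Lemma pevC c : pev (malgC c) = iota c.
Proof. by rewrite pevU monev1 mulr1. Qed.

Lemma pevX j : pev (dX j) = z j.
Proof. by rewrite pevU monevU rmorph1 mul1r. Qed.

Lemma pevE P : pev P = \sum_(m <- msupp P) iota (mcoeff m P) * monev z m.
Proof. by rewrite unlock. Qed.
End Eval.

Lemma deval_pev (K : fieldType) (d : K -> K) P a :
  deval d P a = pev idfun (fun j => iter j d a) P.
Proof. by rewrite unlock. Qed.

(** Universal property of the polynomial ring, with the condition on variables limited to those that
    occur. *)
Lemma pev_unique (K : fieldType) (R : comNzRingType) (iota : {rmorphism K -> R})
    z (phi : {rmorphism dpoly K -> R}) P :
  (forall c, phi (malgC c) = iota c) -> (forall j, doccurs j P -> phi (dX j) = z j) ->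
  phi P = pev iota z P.
Proof.
move=> hC hX; apply: (dpoly_ind_occ (G := fun P => phi P = pev iota z P)).
- by move=> c; rewrite pevC.
- by move=> P1 P2 e1 e2; rewrite !rmorphD e1 e2.
- by move=> P1 P2 e1 e2; rewrite !rmorphM e1 e2.
- by move=> j jP; rewrite pevX hX.
Qed.

Lemma eq_pev (K : fieldType) (R : comNzRingType) (iota : {rmorphism K -> R})
    z z' P : (forall j, doccurs j P -> z j = z' j) -> pev iota z P = pev iota z' P.
Proof.
move=> h; apply: (pev_unique (phi := pev iota z)) => [c|j jP]; first exact: pevC.
by rewrite -h //; exact: pevX.
Qed.

Lemma rmorph_pev (K : fieldType) (R S : comNzRingType) (iota : {rmorphism K -> R})
    (h : {rmorphism R -> S}) (kappa : {rmorphism K -> S}) z P :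
  (forall c, h (iota c) = kappa c) ->
  h (pev iota z P) = pev kappa (h \o z) P.
Proof.
move=> hC; apply: (pev_unique (phi := h \o pev iota z)) => [c|j jP] /=.
  by rewrite pevC.
by rewrite pevX.
Qed.

(** Membership in [K[x_0, ..., x_(n-1)]]; for [n = 0] this means being constant. The one-constructor
    type keeps the quantifier folded. *)
Variant vars_lt (K : fieldType) n (P : dpoly K) : Prop :=
  VarsLt of forall j, doccurs j P -> (j < n)%N.

Lemma vars_ltE (K : fieldType) n (P : dpoly K) j : vars_lt n P -> (n <= j)%N -> ~~ doccurs j P.
Proof. by case=> h nj; apply/negP => /h; lia. Qed.

(** * Polynomials in the first variables, and splitting off one variable *)

Section VarsLt.
Variable K : fieldType.
Implicit Types (P Q : dpoly K).

Lemma vars_ltC n c : vars_lt n (malgC c : dpoly K).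
Proof. by constructor=> j; rewrite doccursC. Qed.
Lemma vars_ltX n i : (i < n)%N -> vars_lt n (dX i : dpoly K).
Proof. by move=> lt; constructor=> j; rewrite doccursX => /eqP <-. Qed.
Lemma vars_ltD n P Q : vars_lt n P -> vars_lt n Q -> vars_lt n (P + Q).
Proof. by move=> [hP] [hQ]; constructor=> j /doccursD /orP[/hP|/hQ]. Qed.
Lemma vars_ltM n P Q : vars_lt n P -> vars_lt n Q -> vars_lt n (P * Q).
Proof. by move=> [hP] [hQ]; constructor=> j /doccursM /orP[/hP|/hQ]. Qed.

Lemma vars_ltS m n P : (m <= n)%N -> vars_lt m P -> vars_lt n P.
Proof. by move=> mn [h]; constructor=> j /h; lia. Qed.

Lemma vars_lt_sum (I : Type) (r : seq I) (F : I -> dpoly K) n :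
  (forall i, vars_lt n (F i)) -> vars_lt n (\sum_(i <- r) F i).
Proof.
move=> h; apply: (big_ind (vars_lt n)) => //; last exact: vars_ltD.
by rewrite -malgC0E; exact: vars_ltC.
Qed.

Lemma vars_ltXn n P k : vars_lt n P -> vars_lt n (P ^+ k).
Proof.
move=> h; elim: k => [|k IH]; first exact: vars_ltC.
by rewrite exprS; apply: vars_ltM.
Qed.

Lemma vars_lt_dord P : vars_lt (dord P).+1 P.
Proof. by constructor=> j /doccurs_le_dord. Qed.

Definition dconst (c : K) : {poly dpoly K} := polyC (malgC c : dpoly K).
Fact dconst_zmod : zmod_morphism dconst.
Proof. by move=> x y; rewrite /dconst monalgUB polyCB. Qed.
Fact dconst_monoid : monoid_morphism dconst.
Proof. by split=> [//|x y]; rewrite /dconst -polyCM (mul_monom x y) mul1m. Qed.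
HB.instance Definition _ := GRing.isZmodMorphism.Build K {poly dpoly K} dconst dconst_zmod.
HB.instance Definition _ := GRing.isMonoidMorphism.Build K {poly dpoly K} dconst dconst_monoid.

(* [P] as a polynomial in [x_n] over the other variables. *)
Definition dsplit n (P : dpoly K) : {poly dpoly K} :=
  pev dconst (fun j => if j == n then 'X else (dX j)%:P) P.
Fact dsplit_zmod n : zmod_morphism (dsplit n).
Proof. exact: pev_zmod. Qed.
Fact dsplit_monoid n : monoid_morphism (dsplit n).
Proof. exact: pev_monoid. Qed.
HB.instance Definition _ n := GRing.isZmodMorphism.Build _ _ (dsplit n) (dsplit_zmod n).
HB.instance Definition _ n := GRing.isMonoidMorphism.Build _ _ (dsplit n) (dsplit_monoid n).

Lemma dsplitD n : {morph dsplit n : P Q / P + Q}.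
Proof. exact: rmorphD. Qed.

Lemma dsplitM n : {morph dsplit n : P Q / P * Q}.
Proof. exact: rmorphM. Qed.

Lemma dsplitC n c : dsplit n (malgC c) = (malgC c)%:P.
Proof. exact: pevC. Qed.

Lemma dsplitX n j : dsplit n (dX j) = if j == n then 'X else (dX j)%:P.
Proof. exact: pevX. Qed.

Lemma dsplit_notin n P : ~~ doccurs n P -> dsplit n P = P%:P.
Proof.
move=> nP; apply/esym; apply: (pev_unique (phi := polyC : {rmorphism dpoly K -> {poly dpoly K}})) => // j jP.
by case: eqP => // ejn; rewrite -ejn jP in nP.
Qed.

Lemma dsplit_vars n P i : vars_lt n.+1 P -> vars_lt n (dsplit n P)`_i.
Proof.
move=> hP; suff : forall i, vars_lt n (dsplit n P)`_i by [].
apply: (dpoly_ind_occ (G := fun P => forall i, vars_lt n (dsplit n P)`_i)).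
- move=> c k; rewrite dsplitC coefC; case: eqP => _; first exact: vars_ltC.
  by rewrite -malgC0E; apply: vars_ltC.
- by move=> P1 P2 h1 h2 k; rewrite dsplitD coefD; apply: vars_ltD.
- move=> P1 P2 h1 h2 k; rewrite dsplitM coefM; apply: vars_lt_sum => l.
  exact: vars_ltM.
- move=> j jP k; have jn : (j <= n)%N by case: hP => /(_ _ jP).
  have z0 : vars_lt n (0 : dpoly K) by rewrite -malgC0E; apply: vars_ltC.
  rewrite dsplitX; case: eqP => [_|ejn]; rewrite (coefX, coefC); case: eqP => _ //=.
    exact: vars_ltC.
  by apply: vars_ltX; lia.
Qed.

Lemma pev_dsplit (R : comNzRingType) (iota : {rmorphism K -> R}) z n P :
  pev iota z P = (map_poly (pev iota z) (dsplit n P)).[z n].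
Proof.
apply/esym; apply: (pev_unique (phi := horner_eval (z n) \o (map_poly (pev iota z) \o dsplit n))).
  by move=> c /=; rewrite /horner_eval dsplitC map_polyC hornerC /= pevC.
move=> j _ /=; rewrite /horner_eval dsplitX; case: eqP => [->|_].
  by rewrite map_polyX hornerX.
by rewrite map_polyC hornerC /= pevX.
Qed.

Lemma dsplitK n P : (dsplit n P).[dX n] = P.
Proof.
transitivity (pev malgC dX P); last first.
  by apply/esym/(pev_unique (phi := idfun)).
rewrite (pev_dsplit _ _ n); congr (_.[_]).
rewrite -[LHS](@map_poly_id _ idfun) //; apply: eq_map_poly => Q.
by apply/(pev_unique (phi := idfun)).
Qed.

Lemma dsplit_horner n (q : {poly dpoly K}) :
  (forall i, ~~ doccurs n q`_i) -> dsplit n q.[dX n] = q.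
Proof.
move=> hq; rewrite horner_coef raddf_sum -[RHS]coefK poly_def.
apply: eq_bigr => i _; rewrite /= dsplitM rmorphXn /= dsplitX eqxx dsplit_notin //.
by rewrite mul_polyC.
Qed.

(** * Partial derivatives and the order *)

Lemma dpartialEw (d : {fset {cmonom nat}}) j P : (msupp P `<=` d)%fset ->
  dpartial j P = \sum_(m <- d) mkmalgU (divcm m (ucm j)) (mcoeff m P *+ m j).
Proof.
move=> sd; apply: big_fset_incl => // m _ /mcoeff_outdom ->.
by rewrite mul0rn monalgU0.
Qed.

Lemma dpartialD j : {morph @dpartial K j : P Q / P + Q}.
Proof.
move=> P Q; pose d := (msupp P `|` msupp Q)%fset.
rewrite (@dpartialEw d _ P) ?fsubsetUl // (@dpartialEw d _ Q) ?fsubsetUr //.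
rewrite (@dpartialEw d) ?msuppD_le // -big_split /=; apply: eq_bigr => m _.
by rewrite mcoeffD mulrnDl monalgUD.
Qed.

Lemma dpartialU j c m :
  dpartial j (mkmalgU m c) = mkmalgU (divcm m (ucm j)) (c *+ m j) :> dpoly K.
Proof. by rewrite (dpartialEw _ msuppU_le) big_seq_fset1 mcoeffUU. Qed.

Lemma dpartial0 j : dpartial j (0 : dpoly K) = 0.
Proof. by rewrite /dpartial msupp0 big_seq_fset0. Qed.

Lemma dpoly_add_ind (G : dpoly K -> Prop) : G 0 ->
  (forall P Q, G P -> G Q -> G (P + Q)) -> (forall m c, G (mkmalgU m c)) ->
  forall P, G P.
Proof.
move=> G0 GD GU P; rewrite (monalgE P); apply: (big_ind G); [exact: G0|exact: GD|].
by move=> m _; exact: GU.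
Qed.

Lemma dpartialM j P Q : dpartial j (P * Q) = dpartial j P * Q + P * dpartial j Q.
Proof.
apply: (dpoly_add_ind (G := fun P => dpartial j (P * Q) = dpartial j P * Q + P * dpartial j Q)) P.
- by rewrite mul0r dpartial0 !mul0r addr0.
- move=> P1 P2; exact: (leibnizDl (dpartialD j)).
move=> m c.
apply: (dpoly_add_ind (G := fun Q => dpartial j (mkmalgU m c * Q) =
  dpartial j (mkmalgU m c) * Q + mkmalgU m c * dpartial j Q)) Q.
- by rewrite mulr0 dpartial0 !mulr0 addr0.
- move=> P1 P2; exact: (leibnizDr (dpartialD j)).
move=> m' c'.
have e1 := etrans (congr1 (dpartial j) (mul_monom c c' m m')) (dpartialU j _ _).
have e2 := etrans (congr1 (fun x => x * mkmalgU m' c') (dpartialU j c m)) (mul_monom _ _ _ _).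
have e3 := etrans (congr1 (fun x => mkmalgU m c * x) (dpartialU j c' m')) (mul_monom _ _ _ _).
apply: (etrans e1); apply: esym; apply: (etrans (congr2 +%R e2 e3)); apply: esym.
have -> : (c * c') *+ (mmul m m' : {cmonom nat}) j = (c *+ m j) * c' + c * (c' *+ m' j).
  by rewrite cmM mulrnDr mulrnAl mulrnAr.
apply: (etrans (monalgUD _ _ _)); apply: (congr2 +%R).
  (* For [m j = 0] the division by [x_j] truncates, but then the coefficient is zero. *)
  case: (posnP (m j)) => [->|mj].
    by rewrite mulr0n mul0r; apply: etrans (monalgU0 _) (esym (monalgU0 _)).
  apply: (congr1 (fun k => mkmalgU k _)); apply/eqP/cmP => i.
  by rewrite !(cmM, divcmE, cmU); case: eqP => [<-|]; lia.
case: (posnP (m' j)) => [->|mj].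
  by rewrite mulr0n mulr0; apply: etrans (monalgU0 _) (esym (monalgU0 _)).
apply: (congr1 (fun k => mkmalgU k _)); apply/eqP/cmP => i.
by rewrite !(cmM, divcmE, cmU); case: eqP => [<-|]; lia.
Qed.

Lemma dpartialC j c : dpartial j (malgC c : dpoly K) = 0.
Proof. by rewrite dpartialU cm1 monalgU0. Qed.

Lemma dpartialX j i : dpartial j (dX i : dpoly K) = (i == j)%:R.
Proof.
rewrite dpartialU cmU; case: eqP => [->|_]; last by rewrite monalgU0.
have -> : divcm (ucm j) (ucm j) = mone by apply/eqP/cmP => k; rewrite divcmE cm1 subnn.
exact: erefl.
Qed.

(** Both sides are additive, obey the same product rule, kill constants and agree on variables. *)
Lemma dpartial_dsplit n P : dpartial n P = (dsplit n P)^`().[dX n].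
Proof.
apply: (dpoly_ind (G := fun P => dpartial n P = (dsplit n P)^`().[dX n])) P.
- by move=> c; rewrite dpartialC dsplitC derivC horner0.
- by move=> P Q hP hQ; rewrite (dpartialD n P Q) (dsplitD n P Q) derivD hornerD -hP -hQ.
- move=> P Q hP hQ.
  by rewrite (dpartialM n P Q) (dsplitM n P Q) derivM hornerD !hornerM (dsplitK n P) (dsplitK n Q) -hP -hQ.
- move=> j; rewrite dpartialX dsplitX; case: eqP => _.
    by rewrite derivX hornerC.
  by rewrite derivC horner0.
Qed.

Lemma mcoeff_dpartial j P m :
  mcoeff m (dpartial j P) = mcoeff (mmul m (ucm j)) P *+ (m j).+1.
Proof.
apply: (dpoly_add_ind (G := fun P => mcoeff m (dpartial j P) =
  mcoeff (mmul m (ucm j)) P *+ (m j).+1)) P.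
- by rewrite dpartial0 !mcoeff0 mul0rn.
- move=> P1 P2 h1 h2; rewrite (dpartialD j P1 P2) (mcoeffD _ (dpartial j P1)).
  by rewrite (mcoeffD _ P1 P2) mulrnDl; exact: (congr2 +%R h1 h2).
move=> m' c; rewrite (dpartialU j c m') !mcoeffU.
have [->|ne] := eqVneq m' (mmul m (ucm j)).
  rewrite cmM cmUU addn1 mulr1n (_ : _ == _) ?mulr1n //.
  by apply/cmP => i; rewrite divcmE cmM addnK.
rewrite mulr0n mul0rn; case: (posnP (m' j)) => [->|mj]; first by rewrite mulr0n mul0rn.
rewrite (_ : (_ == _) = false) ?mulr0n //; apply/negP => /cmP e.
move/eqP: ne; apply; apply/eqP/cmP => i; rewrite cmM -e divcmE cmU.
by case: eqP => [<-|]; lia.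
Qed.

Lemma doccurs_dpartial j P : dpartial j P != 0 -> doccurs j P.
Proof.
rewrite -msupp_eq0 => /fset0Pn[m]; rewrite -mcoeff_neq0 mcoeff_dpartial => ne.
apply/hasP; exists (mmul m (ucm j)); last by rewrite cmM cmUU addn1.
by rewrite -mcoeff_neq0; apply: contra_neq ne => ->; rewrite mul0rn.
Qed.

Lemma in_base_doccurs j P : doccurs j P -> ~ in_base P.
Proof. by move=> jP [c eP]; rewrite eP doccursC in jP. Qed.

Lemma dord_dpartial n P : vars_lt n.+1 P -> dpartial n P != 0 -> dord P = n.
Proof.
move=> hP /doccurs_dpartial nP; apply/eqP; rewrite eqn_leq doccurs_le_dord // andbT.
have [ord _] := dordP (in_base_doccurs nP).
by case: hP => /(_ _ ord).
Qed.

(** With [dord_dpartial], this turns a polynomial with nonzero derivative over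
    [K[x_0, ..., x_(n-1)]] into an [f] of order [n] with nonzero separant, as (2) requires. *)
Lemma dpartial_horner_neq0 n (q : {poly dpoly K}) :
  (forall i, vars_lt n q`_i) -> q^`() != 0 -> dpartial n q.[dX n] != 0.
Proof.
move=> hq; have hn i : ~~ doccurs n q`_i by apply: vars_ltE (hq i) _.
apply: contra_neq; rewrite dpartial_dsplit dsplit_horner // => e0.
rewrite -(@dsplit_horner n q^`()) ?e0 ?rmorph0 // => i.
rewrite coef_deriv; move: (q`_i.+1) (hn i.+1) => c hc.
elim: (i.+1) => [|k IH]; first by rewrite mulr0n -malgC0E doccursC.
by rewrite mulrS; apply/negP => /doccursD; rewrite (negPf IH) (negPf hc).
Qed.

Lemma vars_lt_horner n (q : {poly dpoly K}) :
  (forall i, vars_lt n q`_i) -> vars_lt n.+1 q.[dX n].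
Proof.
move=> hq; rewrite horner_coef; apply: vars_lt_sum => i; apply: vars_ltM.
  exact: vars_ltS (leqnSn n) (hq i).
by apply/vars_ltXn/vars_ltX.
Qed.
End VarsLt.

(** * Extension of derivations *)

Definition der_on (E : fieldType) (F : E -> Prop) (d : E -> E) : Prop :=
  (forall x y, F x -> F y -> d (x + y) = d x + d y) /\
  (forall x y, F x -> F y -> d (x * y) = d x * y + x * d y).

(** A derivation of [R] with values in [E], viewed as an [R]-module through [ev]. *)
Definition der_along (R : nzRingType) (E : fieldType) (ev : R -> E) (d : R -> E) : Prop :=
  (forall x y, d (x + y) = d x + d y) /\
  (forall x y, d (x * y) = d x * ev y + ev x * d y).

Definition frac_of (R : Type) (E : fieldType) (ev : R -> E) (z : E) : Prop :=
  exists x y, ev y != 0 /\ z = ev x / ev y.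

Section DerAlong.
Variables (R : nzRingType) (E : fieldType) (ev : {rmorphism R -> E}) (d : R -> E).
Hypothesis hd : der_along ev d.

Lemma der_along0 : d 0 = 0.
Proof. by have := hd.1 0 0; rewrite addr0 => /eqP; rewrite -subr_eq subrr => /eqP. Qed.

Lemma der_alongN x : d (- x) = - d x.
Proof. by apply/eqP; rewrite -addr_eq0 -hd.1 addNr der_along0. Qed.

Lemma der_along1 : d 1 = 0.
Proof.
have := hd.2 1 1; rewrite mulr1 rmorph1 mulr1 mul1r => /eqP.
by rewrite -subr_eq subrr => /eqP.
Qed.

Lemma der_along_sum (I : Type) (r : seq I) (P : pred I) (F : I -> R) :
  d (\sum_(i <- r | P i) F i) = \sum_(i <- r | P i) d (F i).
Proof. exact: (big_morph d hd.1 der_along0). Qed.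
End DerAlong.

Section ExtFrac.
Variables (R : comNzRingType) (E : fieldType) (ev : {rmorphism R -> E}) (d : R -> E).
Hypothesis hd : der_along ev d.
Hypothesis ker : forall x, ev x = 0 -> d x = 0.

Let quot (x y : R) : E := (d x - ev x / ev y * d y) / ev y.

Let quotE x y x' y' : ev y != 0 -> ev y' != 0 ->
  ev x / ev y = ev x' / ev y' -> quot x y = quot x' y'.
Proof.
move=> y0 y0' e.
have ek : ev (x * y' - x' * y) = 0.
  rewrite rmorphB !rmorphM; apply/eqP; rewrite subr_eq0 -eqr_div //; exact/eqP.
have := ker ek; rewrite hd.1 (der_alongN hd) !hd.2 => e2.
rewrite /quot -e; set r := ev x / ev y in e *.
have ex : ev x = r * ev y by rewrite /r mulfVK.
have ex' : ev x' = r * ev y' by rewrite e mulfVK.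
rewrite ex ex' in e2; apply/eqP; rewrite eqr_div // -subr_eq0; apply/eqP.
rewrite -[RHS]e2; ring.
Qed.

(** The quotient rule. Two expressions of one fraction differ by an element of the kernel of [ev],
    where [d] vanishes, so the value is well defined. *)
Lemma ext_frac : exists d' : E -> E, der_on (frac_of ev) d' /\ forall x, d' (ev x) = d x.
Proof.
pose rel z w := exists x y, [/\ ev y != 0, z = ev x / ev y & w = quot x y].
pose d' z := epsilon (inhabits 0) (rel z).
have d'E x y : ev y != 0 -> d' (ev x / ev y) = quot x y.
  move=> y0; have : rel (ev x / ev y) (d' (ev x / ev y)).
    by apply: epsilon_spec; exists (quot x y), x, y.
  by move=> [x' [y' [y0' e ->]]]; apply: quotE.
exists d'; split; first split.
- move=> _ _ [x [y [y0 ->]]] [x' [y' [y0' ->]]].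
  rewrite addf_div // -!rmorphM -rmorphD d'E ?d'E //; last by rewrite rmorphM mulf_neq0.
  rewrite /quot !hd.1 !hd.2 rmorphD !rmorphM; field; exact/andP.
- move=> _ _ [x [y [y0 ->]]] [x' [y' [y0' ->]]].
  rewrite mulf_div -!rmorphM d'E ?d'E //; last by rewrite rmorphM mulf_neq0.
  rewrite /quot !hd.2 !rmorphM; field; exact/andP.
- move=> x; have -> : ev x = ev x / ev 1 by rewrite rmorph1 divr1.
  rewrite d'E ?rmorph1 ?oner_neq0 // /quot (der_along1 hd) mulr0 subr0 rmorph1 divr1 //.
Qed.
End ExtFrac.

Section PolyDer.
Variables (F : comNzRingType) (E : fieldType) (j : {rmorphism F -> E}) (d : F -> E).
Hypothesis hd : der_along j d.
Variables (t c : E).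

Definition polyder (q : {poly F}) : {poly E} := \poly_(i < size q) d q`_i.

Lemma coef_polyder q i : (polyder q)`_i = d q`_i.
Proof. by rewrite coef_poly; case: ltnP => // /(nth_default _) ->; rewrite (der_along0 hd). Qed.

Lemma polyderD q r : polyder (q + r) = polyder q + polyder r.
Proof. by apply/polyP => i; rewrite coefD !coef_polyder coefD hd.1. Qed.

Lemma polyderM q r : polyder (q * r) = polyder q * map_poly j r + map_poly j q * polyder r.
Proof.
apply/polyP => i; rewrite coefD !coefM coef_polyder coefM (der_along_sum hd) -big_split.
by apply: eq_bigr => k _ /=; rewrite !coef_polyder !coef_map hd.2.
Qed.

Definition ev_at (q : {poly F}) : E := (map_poly j q).[t].
Fact ev_at_zmod : zmod_morphism ev_at.
Proof. by move=> q r; rewrite /ev_at rmorphB hornerD hornerN. Qed.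
HB.instance Definition _ := GRing.isZmodMorphism.Build {poly F} E ev_at ev_at_zmod.
Fact ev_at_monoid : monoid_morphism ev_at.
Proof. by split=> [|q r]; rewrite /ev_at ?rmorph1 ?hornerC // rmorphM hornerM. Qed.
HB.instance Definition _ := GRing.isMonoidMorphism.Build {poly F} E ev_at ev_at_monoid.

Lemma ev_atC a : ev_at a%:P = j a.
Proof. by rewrite /ev_at map_polyC hornerC. Qed.
Lemma ev_atX : ev_at 'X = t.
Proof. by rewrite /ev_at map_polyX hornerX. Qed.

(** The value at [q(t)] forced on any derivation that extends [d] and sends [t] to [c]. *)
Definition polyder_at (q : {poly F}) : E := (polyder q).[t] + ev_at q^`() * c.

Lemma polyder_at_along : der_along ev_at polyder_at.
Proof.
split=> q r; rewrite /polyder_at.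
  by rewrite polyderD derivD hornerD rmorphD /= mulrDl addrACA.
rewrite polyderM derivM hornerD !hornerM rmorphD !rmorphM /= -/(ev_at _) -/(ev_at _).
ring.
Qed.

Lemma polyder_atC a : polyder_at a%:P = d a.
Proof.
rewrite /polyder_at derivC rmorph0 mul0r addr0.
have -> : polyder a%:P = (d a)%:P.
  by apply/polyP => i; rewrite coef_polyder !coefC; case: eqP => // _; rewrite (der_along0 hd).
by rewrite hornerC.
Qed.

Lemma polyder_atX : polyder_at 'X = c.
Proof.
rewrite /polyder_at derivX rmorph1 mul1r.
have -> : polyder 'X = 0.
  apply/polyP => i; rewrite coef_polyder coefX coef0.
  by case: eqP => _ /=; rewrite ?(der_along1 hd) ?(der_along0 hd).
by rewrite horner0 add0r.
Qed.

Lemma ext_simple : (forall q, ev_at q = 0 -> polyder_at q = 0) ->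
  exists d' : E -> E, [/\ der_on (frac_of ev_at) d', forall a, d' (j a) = d a & d' t = c].
Proof.
move=> /(ext_frac polyder_at_along)[d' [hd' hE]]; exists d'; split=> // [a|].
  by rewrite -ev_atC hE polyder_atC.
by rewrite -{1}ev_atX hE polyder_atX.
Qed.
End PolyDer.

Lemma minpoly_at (F E : fieldType) (j : {rmorphism F -> E}) (t : E) (p : {poly F}) :
  p != 0 -> ev_at j t p = 0 ->
  exists m : {poly F}, [/\ m != 0, ev_at j t m = 0 &
    forall q, ev_at j t q = 0 -> m %| q].
Proof.
move=> p0 pt.
have [n [m [m0 mt sm]] min] := ex_minP (ex_intro (fun n => exists m : {poly F},
  [/\ m != 0, ev_at j t m = 0 & size m = n]) _ (ex_intro _ p (And3 p0 pt erefl))).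
exists m; split=> // q qt; rewrite /dvdp; apply/negPn/negP => r0.
have := min _ (ex_intro _ (q %% m) (And3 r0 _ erefl)).
have rt : ev_at j t (q %% m) = 0.
  by have := qt; rewrite {1}(divp_eq q m) rmorphD rmorphM /= mt mulr0 add0r.
by move=> /(_ rt); rewrite -sm leqNgt ltn_modp m0.
Qed.

(** Differentiating [p(t) = 0] forces [c]. Write [p = r m] with [m] minimal; [r(t) <> 0] because [t]
    is a simple root, so the forced derivation kills [m], and hence all relations of [t]. *)
Lemma ext_sep (F E : fieldType) (j : {rmorphism F -> E}) (d : F -> E) (t : E) (p : {poly F}) :
  der_along j d -> ev_at j t p = 0 -> ev_at j t p^`() != 0 ->
  exists c, exists d' : E -> E,
    [/\ der_on (frac_of (ev_at j t)) d', forall a, d' (j a) = d a & d' t = c].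
Proof.
move=> hd pt p't; pose c := - (polyder d p).[t] / ev_at j t p^`(); exists c.
apply: ext_simple => // q qt.
have p0 : p != 0 by apply: contraNneq p't => ->; rewrite deriv0 rmorph0.
have [m [m0 mt mdvd]] := minpoly_at p0 pt.
have hD := polyder_at_along hd t c.
have pc : polyder_at j d t c p = 0 by rewrite /polyder_at [_ * c]mulrC /c divfK // addrN.
have [r er] := dvdpP _ _ (mdvd _ pt); have [s es] := dvdpP _ _ (mdvd _ qt).
have r0 : ev_at j t r != 0.
  apply: contraNneq p't => rt.
  by rewrite er derivM rmorphD !rmorphM /= mt rt mulr0 mul0r addr0.
have mc : polyder_at j d t c m = 0.
  move: pc; rewrite er hD.2 mt mulr0 add0r => /eqP.
  by rewrite mulf_eq0 (negPf r0) => /eqP.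
by rewrite es hD.2 mt mc !mulr0 addr0.
Qed.

(** * Generated subfields and separable towers *)

Inductive fgen (E : fieldType) (P : E -> Prop) : E -> Prop :=
  | fgen_base x of P x : fgen P x
  | fgen1 : fgen P 1
  | fgenB x y of fgen P x & fgen P y : fgen P (x - y)
  | fgenM x y of fgen P x & fgen P y : fgen P (x * y)
  | fgenV x of fgen P x : fgen P x^-1.

Definition addP (E : Type) (P : E -> Prop) (t : E) : E -> Prop := fun x => P x \/ x = t.

Lemma fgen_subring (E : fieldType) (P : E -> Prop) : subring_prop (fgen P).
Proof. by split; [exact: fgen1|exact: fgenB|exact: fgenM]. Qed.

Lemma fgen_min (E : fieldType) (P S : E -> Prop) : subring_prop S ->
  (forall x, S x -> S x^-1) -> (forall x, P x -> S x) -> forall x, fgen P x -> S x.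
Proof.
move=> [S1 SB SM] SV PS x; elim=> {x} //.
- by move=> x y _ Sx _ Sy; apply: SB.
- by move=> x y _ Sx _ Sy; apply: SM.
- by move=> x _ Sx; apply: SV.
Qed.

Lemma fgen_sub (E : fieldType) (P Q : E -> Prop) : (forall x, P x -> Q x) ->
  forall x, fgen P x -> fgen Q x.
Proof.
move=> PQ; apply: fgen_min; [exact: fgen_subring|exact: fgenV|].
by move=> x /PQ; exact: fgen_base.
Qed.

Section FracOf.
Variables (R : comNzRingType) (E : fieldType) (ev : {rmorphism R -> E}).

Lemma frac_of_ev x : frac_of ev (ev x).
Proof. by exists x, 1; rewrite rmorph1 divr1 oner_neq0. Qed.

Lemma frac_of_subring : subring_prop (frac_of ev).
Proof.
split; first by rewrite -(rmorph1 ev); exact: frac_of_ev.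
  move=> _ _ [x [y [y0 ->]]] [x' [y' [y0' ->]]].
  exists (x * y' - x' * y), (y * y'); rewrite !rmorphM rmorphB !rmorphM mulf_neq0 //.
  by split=> //; rewrite -[- (_ / _)]mulNr addf_div // mulNr.
move=> _ _ [x [y [y0 ->]]] [x' [y' [y0' ->]]].
by exists (x * x'), (y * y'); rewrite !rmorphM mulf_neq0 // mulf_div.
Qed.

Lemma frac_ofV x : frac_of ev x -> frac_of ev x^-1.
Proof.
move=> [a [b [b0 ->]]]; have [a0|a0] := eqVneq (ev a) 0.
  by rewrite a0 mul0r invr0 -(rmorph0 ev); exact: frac_of_ev.
by exists b, a; rewrite invf_div.
Qed.

Lemma fgen_frac_of (P : E -> Prop) : (forall x, P x -> exists a, x = ev a) ->
  forall x, fgen P x -> frac_of ev x.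
Proof.
move=> h; apply: fgen_min; [exact: frac_of_subring|exact: frac_ofV|].
by move=> x /h[a ->]; exact: frac_of_ev.
Qed.
End FracOf.

(** Separability is encoded by a simple root of some polynomial, which avoids minimal
    polynomials. *)
Definition sepalg (E : fieldType) (F : E -> Prop) (t : E) : Prop :=
  exists p : {poly E}, [/\ forall i, F p`_i, p.[t] = 0 & p^`().[t] != 0].

Lemma map_poly_lift (A E : nzRingType) (j : {rmorphism A -> E}) (F : E -> Prop) (p : {poly E}) :
  injective j -> (forall x, F x -> exists a, x = j a) -> (forall i, F p`_i) ->
  exists q : {poly A}, p = map_poly j q.
Proof.
move=> ji hF hp; have {}hp i : exists a, p`_i = j a by apply: hF.
pose a i := epsilon (inhabits 0) (fun a => p`_i = j a).
exists (\poly_(i < size p) a i); apply/polyP => i; rewrite coef_map coef_poly.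
case: ltnP => [_|ge]; last by rewrite (nth_default _ ge) /= raddf0.
exact: (epsilon_spec (inhabits 0) (fun a => p`_i = j a)).
Qed.

Section ExtFgen.
Variables (E : fieldType) (P : E -> Prop) (t : E).
Variable (d : E -> E).
Hypothesis hd : der_on (fgen P) d.

Lemma fgen_pack : exists (F : fieldType) (j : {rmorphism F -> E}),
  [/\ forall x, fgen P x <-> exists a, x = j a, der_along j (d \o j) &
   forall x, fgen (addP P t) x -> frac_of (ev_at j t) x].
Proof.
have [F [j jP]] := subfield_pack (fgen_subring P) (fgenV (P := P)).
exists F, j; split=> //.
  have jF a : fgen P (j a) by apply/jP; exists a.
  split=> x y /=; first by rewrite rmorphD hd.1.
  by rewrite rmorphM hd.2.
apply: fgen_frac_of => x [/(fgen_base (P := P))/jP[a ->]|->].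
  by exists a%:P; rewrite [RHS]ev_atC.
by exists 'X; rewrite [RHS]ev_atX.
Qed.

(** Every relation [q(t) = 0] has [q'(t) = 0] here, whether [t] is transcendental or inseparable, so
    the value [1] at [t] meets no obstruction. *)
Lemma ext_fgen_insep : ~ sepalg (fgen P) t -> (forall x, fgen P x -> d x = 0) ->
  exists d', [/\ der_on (fgen (addP P t)) d', forall x, fgen P x -> d' x = d x & d' t = 1].
Proof.
move=> nsep d0; have [F [j [jP hdj frac]]] := fgen_pack.
have jF a : fgen P (j a) by apply/jP; exists a.
have [q qt|d' [hd' d'j d't]] := ext_simple hdj (t := t) (c := 1).
  rewrite /polyder_at mulr1.
  have -> : polyder (d \o j) q = 0.
    by apply/polyP => i; rewrite (coef_polyder hdj) coef0 /= d0.
  rewrite horner0 add0r; apply/eqP/negPn/negP => q'; apply: nsep.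
  exists (map_poly j q); split=> [i||]; first by rewrite coef_map; exact: jF.
    by rewrite -[RHS]qt.
  by rewrite deriv_map.
exists d'; split=> // [|x /jP[a ->]]; last by rewrite d'j.
by split=> x y /frac hx /frac hy; [apply: hd'.1|apply: hd'.2].
Qed.

Lemma ext_fgen_sep : sepalg (fgen P) t ->
  exists d', der_on (fgen (addP P t)) d' /\ forall x, fgen P x -> d' x = d x.
Proof.
move=> [p [pF pt p't]]; have [F [j [jP hdj frac]]] := fgen_pack.
have [q eq] : exists q : {poly F}, p = map_poly j q.
  by apply: map_poly_lift pF => [|x /jP//]; exact: fmorph_inj.
rewrite {}eq in pt p't; have [||c [d' [hd' d'j d't]]] := ext_sep (t := t) (p := q) hdj.
- by rewrite -[RHS]pt.
- by move: p't; rewrite deriv_map.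
exists d'; split=> // [|x /jP[a ->]]; last by rewrite d'j.
by split=> x y /frac hx /frac hy; [apply: hd'.1|apply: hd'.2].
Qed.
End ExtFgen.

Fixpoint tower (E : fieldType) (P : E -> Prop) (s : seq E) : Prop :=
  if s is t :: s' then sepalg (fgen P) t /\ tower (addP P t) s' else True.

(* If [t] were not separable over [fgen P], the derivation vanishing on [P] with
   [t |-> 1] would exist and extend to [E] along the rest of the tower. *)
Lemma derivation_tower (E : fieldType) (s : seq E) (P : E -> Prop) :
  (forall x, fgen (fun x => P x \/ x \in s) x) ->
  (forall d : E -> E, is_derivation d -> (forall x, P x -> d x = 0) -> forall x, d x = 0) ->
  tower P s /\ forall d, der_on (fgen P) d ->
    exists2 d' : E -> E, is_derivation d' & forall x, fgen P x -> d' x = d x.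
Proof.
elim: s P => [|t s IH] P gen triv.
  split=> // d hd; exists d => //.
  have genP x : fgen P x by apply: fgen_sub (gen x) => y [].
  by split=> x y; [apply: hd.1|apply: hd.2].
have [] := IH (addP P t).
- move=> x; apply: fgen_sub (gen x) => y; rewrite inE /addP.
  by case=> [?|/orP[/eqP ->|?]]; [left; left|left; right|right].
- by move=> d hd dP; apply: triv => // x Px; apply: dP; left.
move=> tow ext.
have sub x : fgen P x -> fgen (addP P t) x by apply: fgen_sub => y; left.
have sep : sepalg (fgen P) t.
  apply: NNPP => nsep.
  have [||d' [hd' d'P d't]] := ext_fgen_insep (d := fun=> 0) _ nsep.
  - by split=> x y _ _; rewrite ?mul0r ?mulr0 ?addr0.
  - by [].
  have [d'' hd'' d''E] := ext _ hd'.
  have d''0 x : P x -> d'' x = 0.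
    by move=> /(fgen_base (P := P)) Px; rewrite d''E ?d'P //; exact: sub.
  have := triv _ hd'' d''0 t; rewrite d''E ?d't; last by apply: fgen_base; right.
  by move/eqP; rewrite oner_eq0.
split=> [//|d hd]; have [d' [hd' d'P]] := ext_fgen_sep hd sep.
have [d'' hd'' d''E] := ext _ hd'; exists d'' => // x Px.
by rewrite d''E ?d'P //; exact: sub.
Qed.

(** * Specializations along a simple separable extension *)

Lemma rmorph_pack (A B : nzRingType) (f : A -> B) :
  zmod_morphism f -> monoid_morphism f -> exists g : {rmorphism A -> B}, g =1 f.
Proof.
move=> fz fm.
pose z := GRing.isZmodMorphism.Build A B f fz.
pose m := GRing.isMonoidMorphism.Build A B f fm.
pose g : {rmorphism A -> B} := HB.pack f z m.
by exists g.
Qed.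

Definition separably_closed (K : fieldType) : Prop :=
  forall p : {poly K}, (1 < size p)%N -> coprimep p p^`() -> exists x, root p x.

(** * Minimal polynomials over a domain *)

Section MinPoly.
Variables (A : idomainType) (E : fieldType) (j : {rmorphism A -> E}) (t : E).
Hypothesis jI : injective j.
Local Notation ev := (ev_at j t).

(** Over a domain such a polynomial cannot be normalized to be monic; divisibility by it holds up to
    powers of its leading coefficient. *)
Record is_minpoly (m : {poly A}) : Prop := IsMinpoly {
  minpoly_neq0 : m != 0;
  minpoly_root : ev m = 0;
  minpoly_min : forall q, q != 0 -> ev q = 0 -> (size m <= size q)%N }.

Lemma ex_minpoly p : p != 0 -> ev p = 0 -> exists m, is_minpoly m.
Proof.
move=> p0 pt.
have [n [m [m0 mt sm]] min] := ex_minP (ex_intro (fun n => exists m : {poly A},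
  [/\ m != 0, ev m = 0 & size m = n]) _ (ex_intro _ p (And3 p0 pt erefl))).
by exists m; split=> // q q0 qt; rewrite sm; apply: min; exists q.
Qed.

Lemma ev_at_scale a q : ev (a *: q) = j a * ev q.
Proof. by rewrite -mul_polyC rmorphM /= ev_atC. Qed.

Variable m : {poly A}.
Hypothesis hm : is_minpoly m.

Lemma minpoly_dvd q : ev q = 0 ->
  exists k r, lead_coef m ^+ k *: q = r * m.
Proof.
case: hm => m0 mt min qt; have e := Pdiv.Idomain.divp_eq q m.
exists (scalp q m), (q %/ m); rewrite e; suff -> : q %% m = 0 by rewrite addr0.
apply/eqP/negPn/negP => r0; have := Pdiv.Idomain.ltn_modp q m.
rewrite m0 ltnNge min //; move/(congr1 ev): e.
by rewrite ev_at_scale rmorphD rmorphM /= qt mt !mulr0 add0r.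
Qed.

Lemma minpoly_size : (1 < size m)%N.
Proof.
case: hm => m0 mt _; rewrite ltnNge; apply/negP => /size1_polyC em.
move: m0 mt; rewrite em ev_atC polyC_eq0 => /negP h /eqP.
by rewrite -(rmorph0 j) (inj_eq jI).
Qed.

(* A nonzero element of minimal degree in the ideal of [m] and [b] is constant, as
   it divides both up to scalars and does not vanish at [t]. *)
Lemma minpoly_bezout b : ev b != 0 ->
  exists u v c, c != 0 /\ u * m + v * b = c%:P.
Proof.
move=> bt; have [m0 mt min] := hm.
have b0 : b != 0 by apply: contraNneq bt => ->; rewrite rmorph0.
have eb : 0 * m + 1 * b = b by rewrite mul0r mul1r add0r.
have [n [u [v [h0 sn]]] minn] := ex_minP (ex_intro (fun n => exists u v,
  u * m + v * b != 0 /\ size (u * m + v * b) = n) _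
  (ex_intro _ 0 (ex_intro _ 1 (conj (etrans (congr1 (fun x => x != 0) eb) b0) erefl)))).
set h := u * m + v * b in h0 sn.
have pdvd q : (exists u' v', q = u' * m + v' * b) ->
    exists k r, lead_coef h ^+ k *: q = r * h.
  move=> [u' [v' eq]]; have e := Pdiv.Idomain.divp_eq q h.
  exists (scalp q h), (q %/ h); rewrite e; suff -> : q %% h = 0 by rewrite addr0.
  apply/eqP/negPn/negP => r0; have := Pdiv.Idomain.ltn_modp q h.
  rewrite h0 ltnNge sn minn //; set l := lead_coef h ^+ _ in e.
  exists (l *: u' - (q %/ h) * u), (l *: v' - (q %/ h) * v).
  suff -> : (l *: u' - q %/ h * u) * m + (l *: v' - q %/ h * v) * b = q %% h by [].
  have -> : q %% h = l *: q - q %/ h * h by rewrite e addrC addKr.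
  rewrite eq /h -!mul_polyC; ring.
have lh : lead_coef h != 0 by rewrite lead_coef_eq0.
have [k [r er]] : exists k r, lead_coef h ^+ k *: m = r * h.
  by apply: pdvd; exists 1, 0; rewrite mul1r mul0r addr0.
have [k' [r' er']] : exists k r, lead_coef h ^+ k *: b = r * h.
  by apply: pdvd; exists 0, 1; rewrite mul1r mul0r add0r.
have jl i : j (lead_coef h ^+ i) != 0.
  by rewrite rmorphXn expf_neq0 // -(rmorph0 j) (inj_eq jI).
have ht : ev h != 0.
  apply: contraNneq bt => ht; move/(congr1 ev): er'.
  by rewrite ev_at_scale rmorphM /= ht mulr0 => /eqP; rewrite mulf_eq0 (negPf (jl _)).
have r0 : r != 0.
  apply: contraNneq m0 => r0; move/eqP: er.
  by rewrite r0 mul0r -mul_polyC mulf_eq0 polyC_eq0 expf_eq0 (negPf lh) andbF.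
have rt : ev r = 0.
  move/(congr1 ev): er; rewrite ev_at_scale rmorphM /= mt mulr0 => /esym/eqP.
  by rewrite mulf_eq0 (negPf ht) orbF => /eqP.
have sm : size m = (size r + size h).-1.
  by rewrite -size_mul // -er size_scale // expf_neq0.
have : (size h <= 1)%N.
  have := min _ r0 rt; rewrite sm.
  have : (0 < size r)%N by rewrite size_poly_gt0.
  move: (size r) (size h) => n1 n2; lia.
move/size1_polyC => eh; exists u, v, h`_0; split=> //.
by rewrite -polyC_eq0 -eh.
Qed.

Lemma minpoly_sep p : p != 0 -> ev p = 0 -> ev p^`() != 0 -> ev m^`() != 0.
Proof.
move=> p0 pt; have [k [r e]] := minpoly_dvd pt.
apply: contraNneq => m't; move/(congr1 (fun q => ev q^`())): e.
rewrite /= derivZ derivM ev_at_scale rmorphD !rmorphM /= m't (minpoly_root hm) !mulr0 addr0.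
move/eqP; rewrite mulf_eq0 => /orP[|//].
by rewrite -(rmorph0 j) (inj_eq jI) expf_eq0 lead_coef_eq0 (negPf (minpoly_neq0 hm)) andbF.
Qed.
End MinPoly.

Lemma subring_ev_at (A : comNzRingType) (E : fieldType) (j : {rmorphism A -> E}) t :
  subring_prop (fun x => exists q, x = ev_at j t q).
Proof.
split; first by exists 1; rewrite rmorph1.
  by move=> _ _ [q ->] [r ->]; exists (q - r); rewrite rmorphB.
by move=> _ _ [q ->] [r ->]; exists (q * r); rewrite rmorphM.
Qed.

(** [B] is [A[t]], and [m] is a minimal polynomial of [t]. A morphism [psi] on [A] extends by
    sending [t] to any root of the image of [m]; the element [g] excludes the bad [psi]. *)
Lemma simple_ext (A : idomainType) (E : fieldType) (j : {rmorphism A -> E}) (t : E)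
    (p : {poly A}) :
  injective j -> ev_at j t p = 0 -> ev_at j t p^`() != 0 ->
  exists (B : idomainType) (k : {rmorphism B -> E}), [/\ injective k,
    forall x, (exists b, x = k b) <-> exists q, x = ev_at j t q &
    forall (K : fieldType) (b : B), b != 0 ->
    exists (m : {poly A}) (g : A), [/\ g != 0, m^`() != 0 &
      forall psi : {rmorphism A -> K}, psi g != 0 ->
        [/\ (1 < size (map_poly psi m))%N,
            coprimep (map_poly psi m) (map_poly psi m)^`() &
            forall xi, root (map_poly psi m) xi ->
              exists psi' : {rmorphism B -> K}, psi' b != 0 /\
                forall q x, k x = ev_at j t q -> psi' x = (map_poly psi q).[xi]]]].
Proof.
move=> jI pt p't.
have p0 : p != 0 by apply: contraNneq p't => ->; rewrite deriv0 rmorph0.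
have [m hm] := ex_minpoly p0 pt.
have [B [k [kI kP]]] := subring_pack (subring_ev_at j t).
exists B, k; split=> // [x|K b b0]; first by split=> /kP.
have [qb eb] : exists q, k b = ev_at j t q by apply/kP; exists b.
have qb0 : ev_at j t qb != 0 by rewrite -eb -(rmorph0 k) (inj_eq kI).
have m't := minpoly_sep jI hm p0 pt p't.
have [u1 [v1 [c1 [c10 e1]]]] := minpoly_bezout jI hm m't.
have [u2 [v2 [c2 [c20 e2]]]] := minpoly_bezout jI hm qb0.
(* If [lead_coef m] survives under [psi], all relations of [t] are respected. The Bezout constant
   [c1] keeps the image of [m] separable, and [c2] keeps the image of [b] nonzero. *)
exists m, (lead_coef m * c1 * c2); split.
- by rewrite !mulf_neq0 // lead_coef_eq0 (minpoly_neq0 hm).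
- by apply: contraNneq m't => ->; rewrite rmorph0.
move=> psi; rewrite !rmorphM !mulf_eq0 !negb_or => /andP[/andP[pl pc1] pc2].
split.
- by rewrite size_map_poly_id0 // (minpoly_size jI hm).
- apply/Bezout_eq1_coprimepP.
  exists ((psi c1)^-1 *: map_poly psi u1, (psi c1)^-1 *: map_poly psi v1) => /=.
  rewrite deriv_map -!scalerAl -scalerDr -!rmorphM -rmorphD e1 /= map_polyC /=.
  by rewrite -mul_polyC -polyCM mulVf.
move=> xi /rootP mxi.
have ker q : ev_at j t q = 0 -> (map_poly psi q).[xi] = 0.
  move=> /(minpoly_dvd hm)[n [r /(congr1 (fun q => (map_poly psi q).[xi]))]].
  rewrite /= -mul_polyC !rmorphM /= !hornerM map_polyC hornerC mxi mulr0 => /eqP.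
  by rewrite mulf_eq0 /= rmorphXn expf_eq0 (negPf pl) andbF => /eqP.
have ker2 q r : ev_at j t q = ev_at j t r -> (map_poly psi q).[xi] = (map_poly psi r).[xi].
  move=> e; apply/eqP; rewrite -subr_eq0 -hornerN -hornerD -rmorphB /=; apply/eqP/ker.
  by rewrite rmorphB /= e subrr.
pose Q x := epsilon (inhabits 0) (fun q => k x = ev_at j t q).
have QE x : k x = ev_at j t (Q x).
  by apply: (epsilon_spec (inhabits 0) (fun q => k x = ev_at j t q)); apply/kP; exists x.
pose f x := (map_poly psi (Q x)).[xi].
have fE q x : k x = ev_at j t q -> f x = (map_poly psi q).[xi].
  by move=> e; apply: ker2; rewrite -QE.
have [||psi' psi'E] := @rmorph_pack B K f.
- move=> x y; have e : k (x - y) = ev_at j t (Q x - Q y) by rewrite !rmorphB /= -!QE.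
  by rewrite (fE _ _ e) rmorphB hornerD hornerN.
- split=> [|x y]; first by rewrite (fE 1) ?rmorph1 ?hornerC // rmorph1.
  have e : k (x * y) = ev_at j t (Q x * Q y) by rewrite !rmorphM /= -!QE.
  by rewrite (fE _ _ e) rmorphM hornerM.
exists psi'; split; last by move=> q x e; rewrite psi'E; apply: fE.
rewrite psi'E (fE _ _ eb); apply: contraNneq pc2 => b'0.
move/(congr1 (fun q => (map_poly psi q).[xi])): e2.
by rewrite /= rmorphD !rmorphM /= hornerD !hornerM mxi b'0 !mulr0 addr0 map_polyC hornerC => <-.
Qed.

(** * Places compatible with derivations *)

Lemma der_along_comp (A : nzRingType) (E : fieldType) (k : {rmorphism A -> E}) (D : E -> E) :
  is_derivation D -> der_along k (D \o k).
Proof.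
by move=> [DD DM]; split=> x y /=; rewrite ?rmorphD ?rmorphM ?DD ?DM.
Qed.

Lemma derivation_ev_at (A : comNzRingType) (E : fieldType) (k : {rmorphism A -> E})
    (D : E -> E) t q : is_derivation D ->
  D (ev_at k t q) = polyder_at k (D \o k) t (D t) q.
Proof.
move=> hD; have hk := der_along_comp k hD; have [DD DM] := hD.
have [PD PM] := polyder_at_along hk t (D t).
elim/poly_ind: q => [|q c IH].
  by rewrite -polyC0 ev_atC polyder_atC.
rewrite rmorphD rmorphM /= DD DM PD PM IH ev_atX ev_atC polyder_atX //.
by rewrite polyder_atC.
Qed.

Lemma derivation0 (E : fieldType) (D : E -> E) : is_derivation D -> D 0 = 0.
Proof. by move=> hD; have := der_along0 (der_along_comp idfun hD). Qed.
Lemma derivation1 (E : fieldType) (D : E -> E) : is_derivation D -> D 1 = 0.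
Proof. by move=> hD; have := der_along1 (der_along_comp idfun hD). Qed.
Lemma derivationN (E : fieldType) (D : E -> E) x : is_derivation D -> D (- x) = - D x.
Proof. by move=> hD; have := der_alongN (der_along_comp idfun hD) x. Qed.
Lemma derivationV (E : fieldType) (D : E -> E) x : is_derivation D -> D x^-1 = - D x / x ^+ 2.
Proof.
move=> hD; have [->|x0] := eqVneq x 0; first by rewrite invr0 derivation0 // oppr0 mul0r.
have := hD.2 x x^-1; rewrite mulfV // derivation1 // => /esym/eqP.
rewrite addrC addr_eq0 => /eqP e; apply: (mulfI x0); rewrite e; field; exact: x0.
Qed.

Section Place.
Variables (B : idomainType) (E K : fieldType) (k : {rmorphism B -> E}).
Variable psi : {rmorphism B -> K}.
Hypothesis kI : injective k.

(* [z] is a fraction whose denominator is not killed by [psi], and its image under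
   the extension of [psi] to such fractions is [c]. *)
Definition place (z : E) (c : K) : Prop :=
  exists x y, [/\ psi y != 0, z * k y = k x & psi x = c * psi y].

Lemma place_base x : place (k x) (psi x).
Proof. by exists x, 1; rewrite !rmorph1 !mulr1 oner_neq0. Qed.

Lemma place1 : place 1 1.
Proof. by have := place_base 1; rewrite !rmorph1. Qed.

Lemma placeB z z' c c' : place z c -> place z' c' -> place (z - z') (c - c').
Proof.
move=> [x [y [y0 e e']]] [x2 [y2 [y20 e2 e2']]].
exists (x * y2 - x2 * y), (y * y2); rewrite !rmorphB !rmorphM -e -e2 e' e2' mulf_neq0 //.
by split=> //; ring.
Qed.

Lemma placeM z z' c c' : place z c -> place z' c' -> place (z * z') (c * c').
Proof.
move=> [x [y [y0 e e']]] [x2 [y2 [y20 e2 e2']]].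
exists (x * x2), (y * y2); rewrite !rmorphM -e -e2 e' e2' mulf_neq0 //.
by split=> //; ring.
Qed.

Lemma place0 : place 0 0.
Proof. by have := place_base 0; rewrite !rmorph0. Qed.

Lemma placeN z c : place z c -> place (- z) (- c).
Proof. by move=> /(placeB place0); rewrite !sub0r. Qed.

Lemma placeD z z' c c' : place z c -> place z' c' -> place (z + z') (c + c').
Proof. by move=> h /placeN /(placeB h); rewrite !opprK. Qed.

Lemma place_sum (I : Type) (r : seq I) (F : I -> E) (G : I -> K) :
  (forall i, place (F i) (G i)) -> place (\sum_(i <- r) F i) (\sum_(i <- r) G i).
Proof. by move=> h; apply: (big_ind2 place) => //; [exact: place0|move=> *; exact: placeD]. Qed.

Lemma placeX z c n : place z c -> place (z ^+ n) (c ^+ n).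
Proof.
move=> h; elim: n => [|n IH]; first by rewrite !expr0; exact: place1.
by rewrite !exprS; apply: placeM.
Qed.

Lemma place_neq0 z c : place z c -> c != 0 -> z != 0.
Proof.
move=> [x [y [y0 e e']]]; apply: contra_neq => z0.
move: e; rewrite z0 mul0r -(rmorph0 k) => /kI ex.
by apply/eqP; move/eqP: e'; rewrite -ex rmorph0 eq_sym mulf_eq0 (negPf y0) orbF.
Qed.

Lemma placeV z c : place z c -> c != 0 -> place z^-1 c^-1.
Proof.
move=> h c0; have z0 := place_neq0 h c0; case: h => x [y [y0 e e']].
exists y, x; rewrite -e e' mulf_neq0 // mulKf // mulKf //.
Qed.

Variables (D : E -> E) (delta : K -> K).
Hypotheses (hD : is_derivation D) (hdelta : is_derivation delta).

(** Stated through [place], as [D] may map the image of [B] outside itself. *)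
Definition compat x := place (D (k x)) (delta (psi x)).

Lemma compat1 : compat 1.
Proof. by rewrite /compat !rmorph1 !derivation1 //; exact: place0. Qed.

Lemma compatB x y : compat x -> compat y -> compat (x - y).
Proof.
rewrite /compat !rmorphB /= hD.1 hdelta.1 (derivationN _ hD) (derivationN _ hdelta).
exact: placeB.
Qed.

Lemma compatD x y : compat x -> compat y -> compat (x + y).
Proof. rewrite /compat !rmorphD /= hD.1 hdelta.1 //; exact: placeD. Qed.

Lemma compatM x y : compat x -> compat y -> compat (x * y).
Proof.
rewrite /compat !rmorphM /= hD.2 hdelta.2 // => hx hy.
by apply: placeD; apply: placeM => //; exact: place_base.
Qed.

Lemma compat_horner (q : {poly B}) x : (forall i, compat q`_i) -> compat x -> compat q.[x].
Proof.
move=> hq hx; rewrite horner_coef; apply: (big_ind compat).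
- by rewrite -(subrr 1); apply: compatB; exact: compat1.
- exact: compatD.
move=> i _; apply: compatM => //; elim: (i : nat) => [|n IH]; first exact: compat1.
by rewrite exprS; apply: compatM.
Qed.

(** A derivation is determined at a simple root by its values on the coefficients. The same formula
    holds in [E] and in [K], and its denominator has nonzero image. *)
Lemma compat_root (q : {poly B}) x : (forall i, compat q`_i) ->
  q.[x] = 0 -> psi q^`().[x] != 0 -> compat x.
Proof.
move=> hq qx q'x.
have ev_k (L : fieldType) (h : {rmorphism B -> L}) r : ev_at h (h x) r = h r.[x].
  by rewrite /ev_at horner_map.
have eE := derivation_ev_at k (k x) q hD.
have eK := derivation_ev_at psi (psi x) q hdelta.
rewrite /polyder_at !ev_k qx rmorph0 derivation0 // in eE.
rewrite /polyder_at !ev_k qx rmorph0 derivation0 // in eK.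
have hk := der_along_comp k hD; have hp := der_along_comp psi hdelta.
have hS : place (polyder (D \o k) q).[k x] (polyder (delta \o psi) q).[psi x].
  rewrite (horner_coef_wide _ (size_poly _ _)) (@horner_coef_wide _ (size q) (polyder (delta \o psi) q)) ?size_poly //.
  apply: place_sum => i; rewrite (coef_polyder hk) (coef_polyder hp).
  by apply: placeM; [exact: hq|apply: placeX; exact: place_base].
have k'x : k q^`().[x] != 0 := place_neq0 (place_base _) q'x.
rewrite /compat; have -> : D (k x) = - (polyder (D \o k) q).[k x] / k q^`().[x].
  by apply: (mulfI k'x); rewrite mulrCA mulfV // mulr1; apply/eqP; rewrite -addr_eq0 addrC -eE.
have -> : delta (psi x) = - (polyder (delta \o psi) q).[psi x] / psi q^`().[x].
  by apply: (mulfI q'x); rewrite mulrCA mulfV // mulr1; apply/eqP; rewrite -addr_eq0 addrC -eK.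
by apply: placeM; [exact: placeN|apply: placeV; [exact: place_base|]].
Qed.

(** Quotient rule in the form [D z = (D x - z * D y) / y] for [z = x / y]. *)
Lemma place_der z c : (forall x, compat x) -> place z c -> place (D z) (delta c).
Proof.
move=> hc h; have [x [y [y0 e e']]] := h.
have ky0 : k y != 0 := place_neq0 (place_base _) y0.
have -> : D z = (D (k x) - z * D (k y)) / k y.
  by rewrite -e hD.2 addrK mulfK.
have -> : delta c = (delta (psi x) - c * delta (psi y)) / psi y.
  by rewrite e' hdelta.2 addrK mulfK.
apply: placeM; last by apply: placeV; [exact: place_base|].
by apply: placeB; [exact: hc|apply: placeM; [|exact: hc]].
Qed.
End Place.

Lemma frac_of_common (A : idomainType) (E : fieldType) (j : {rmorphism A -> E}) (s : seq E) :
  injective j -> (forall x, x \in s -> frac_of j x) ->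
  exists2 a, a != 0 & forall x, x \in s -> exists b, x * j a = j b.
Proof.
move=> jI; elim: s => [|x s IH] hs; first by exists 1; rewrite ?oner_neq0.
have [|a a0 ha] := IH; first by move=> y ys; apply: hs; rewrite inE ys orbT.
have [|u [v [v0 e]]] := hs x; first by rewrite inE eqxx.
exists (a * v).
  by rewrite mulf_neq0 //; apply: contraNneq v0 => ->; rewrite rmorph0.
move=> y; rewrite inE => /orP[/eqP ->|/ha[b eb]].
  by exists (u * a); rewrite !rmorphM /= e mulrCA divfK // mulrC.
by exists (b * v); rewrite !rmorphM /= mulrA eb.
Qed.

Lemma clear_denominators (A : idomainType) (E : fieldType) (j : {rmorphism A -> E})
    (p : {poly E}) : injective j -> (forall i, frac_of j p`_i) ->
  exists a (q : {poly A}), a != 0 /\ j a *: p = map_poly j q.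
Proof.
move=> jI hp; have [x /(nthP 0)[i _ <-] //|a a0 ha] := frac_of_common (s := p) jI.
suff [q eq] : exists q, j a *: p = map_poly j q by exists a, q.
apply: (map_poly_lift (F := fun x => exists b, x = j b)) => // i.
rewrite coefZ mulrC; have [lt|ge] := ltnP i (size p).
  by have [b] := ha _ (mem_nth 0 lt); exists b.
by exists 0; rewrite nth_default // mul0r rmorph0.
Qed.

(** Clearing denominators turns a separable equation over the fractions of [A] into one over [A]. *)
Lemma sepalg_lift (A : idomainType) (E : fieldType) (j : {rmorphism A -> E}) t :
  injective j -> sepalg (fgen (fun x => exists a, x = j a)) t ->
  exists p : {poly A}, ev_at j t p = 0 /\ ev_at j t p^`() != 0.
Proof.
move=> jI [p [pF pt p't]].
have [i|a [q [a0 eq]]] := @clear_denominators _ _ j p jI.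
  by apply: fgen_frac_of (pF i).
exists q; rewrite /ev_at -deriv_map -eq derivZ !hornerZ pt mulr0; split=> //.
by rewrite mulf_neq0 // -(rmorph0 j) (inj_eq jI).
Qed.

Lemma tower_sub (E : fieldType) (s : seq E) (P Q : E -> Prop) :
  (forall x, P x -> Q x) -> tower P s -> tower Q s.
Proof.
elim: s P Q => //= t s IH P Q PQ [[p [pF pt p't]] tow]; split.
  by exists p; split=> // i; apply: fgen_sub (pF i).
by apply: IH tow => x [/PQ|]; [left|right].
Qed.

(** * Specialization along a tower *)

Section Chain.
Variables (E K : fieldType) (D : E -> E) (delta : K -> K).
Hypotheses (hD : is_derivation D) (hdelta : is_derivation delta).
Hypothesis sc : separably_closed K.

(** Iterates [simple_ext]. The last two clauses say which morphisms extend to [B] with a prescribed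
    [b] kept nonzero, and that compatibility with the derivations spreads from [A] to [B] once [b0]
    is not killed. *)
Lemma tower_specialize (s : seq E) (A : idomainType) (j : {rmorphism A -> E}) :
  injective j -> tower (fun x => exists a, x = j a) s ->
  exists (B : idomainType) (k : {rmorphism B -> E}) (b0 : B), [/\ injective k,
    forall a, exists b, j a = k b,
    forall t, t \in s -> exists b, t = k b,
    b0 != 0 &
    (forall b, b != 0 -> exists2 g, g != 0 & forall psi : {rmorphism A -> K}, psi g != 0 ->
       exists psi' : {rmorphism B -> K}, psi' b != 0 /\ forall a x, j a = k x -> psi a = psi' x) /\
    (forall psi : {rmorphism B -> K}, psi b0 != 0 ->
       (forall a x, j a = k x -> compat k psi D delta x) -> forall x, compat k psi D delta x)].
Proof.
elim: s A j => [|t s IH] A j jI.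
  move=> _; exists A, j, 1; split=> // [a||]; first by exists a.
    by rewrite oner_neq0.
  split=> [b b0|psi _ h x]; last exact: h.
  by exists b => // psi pb; exists psi; split=> // a x /jI ->.
move=> [/(sepalg_lift jI)[p [pt p't]] tow].
have [A1 [j1 [j1I j1P ext]]] := simple_ext jI pt p't.
have jj1 a : exists b, j a = j1 b by apply/j1P; exists a%:P; rewrite ev_atC.
have tj1 : exists b, t = j1 b by apply/j1P; exists 'X; rewrite ev_atX.
have [|B [k [b0 [kI j1k sk b00 [good comp]]]]] := IH A1 j1 j1I.
  by apply: tower_sub tow => x [[a ->]|->].
have jk a : exists b, j a = k b by have [b ->] := jj1 a; exact: j1k.
have [t1 et1] := tj1; have [xt ext'] := j1k t1; rewrite -et1 in ext'.
have lift q : exists q' : {poly B}, map_poly j q = map_poly k q'.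
  apply: (map_poly_lift (F := fun x => exists b, x = k b)) => // i.
  by rewrite coef_map; exact: jk.
have evk q q' : map_poly j q = map_poly k q' -> ev_at j t q = k q'.[xt].
  by move=> e; rewrite /ev_at e ext' horner_map.
have [p1 ep1] := lift p.
have p1't : k p1^`().[xt] != 0.
  by rewrite -(evk p^`()) // -deriv_map ep1 deriv_map.
(* The new factor keeps [t] a simple root after specialization. *)
exists B, k, (b0 * p1^`().[xt]); split=> //.
- by move=> u; rewrite inE => /orP[/eqP ->|/sk//]; exists xt.
- by rewrite mulf_neq0 //; apply: contraNneq p1't => ->; rewrite rmorph0.
split=> [b bn0|psi].
  (* Conditions are pulled back from the top: [b] in [B] yields [g1] in [A1], which yields [g] in
     [A]. *)
  have [g1 g10 hg1] := good b bn0.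
  have [m [g [g0 _ hg]]] := ext K g1 g10.
  exists g => // psi /hg[sz cop root]; have [xi /root[psi1 [p1g p1E]]] := sc sz cop.
  have [psi' [p'b p'E]] := hg1 _ p1g; exists psi'; split=> // a x e.
  have [a1 ea1] := jj1 a; rewrite -(p'E a1) -?ea1 //.
  by rewrite (p1E a%:P) ?ev_atC // map_polyC hornerC.
rewrite rmorphM mulf_eq0 negb_or => /andP[pb0 pp1] hA; apply: comp => // a1 x e.
have [q eq] : exists q, j1 a1 = ev_at j t q by apply/j1P; exists a1.
have [q' eq'] := lift q.
have ex : x = q'.[xt] by apply: kI; rewrite -e eq; exact: evk.
have coefc q1 q2 i : map_poly j q1 = map_poly k q2 -> compat k psi D delta q2`_i.
  by move=> e12; apply: (hA q1`_i); rewrite -!coef_map e12.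
rewrite ex; apply: compat_horner => // [i|]; first exact: coefc eq'.
apply: (compat_root kI hD hdelta (q := p1)) => // [i|]; first exact: coefc ep1.
by apply: kI; rewrite -(evk p) // pt rmorph0.
Qed.
End Chain.

(** * Dual derivations and cyclic elements *)

Section DerComb.
Variable E : fieldType.
Implicit Types d : E -> E.

Lemma is_derivation_scale c d : is_derivation d -> is_derivation (fun x => c * d x).
Proof. by move=> [dD dM]; split=> x y; rewrite ?dD ?dM; ring. Qed.

Lemma is_derivation_sub d d' : is_derivation d -> is_derivation d' ->
  is_derivation (fun x => d x - d' x).
Proof. by move=> [dD dM] [dD' dM']; split=> x y; rewrite ?dD ?dM ?dD' ?dM'; ring. Qed.

Lemma is_derivation_sum (I : Type) (r : seq I) (F : I -> E -> E) :
  (forall i, is_derivation (F i)) -> is_derivation (fun x => \sum_(i <- r) F i x).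
Proof.
move=> hF; split=> x y.
  by rewrite -big_split; apply: eq_bigr => i _; rewrite (hF i).1.
by rewrite mulr_suml mulr_sumr -big_split; apply: eq_bigr => i _; rewrite (hF i).2.
Qed.

Lemma is_derivation_comm d d' : is_derivation d -> is_derivation d' ->
  is_derivation (fun x => d (d' x) - d' (d x)).
Proof.
by move=> [dD dM] [dD' dM']; split=> x y; rewrite !(dD, dM, dD', dM'); ring.
Qed.

Lemma derivation_sum (I : Type) (r : seq I) d (F : I -> E) : is_derivation d ->
  d (\sum_(i <- r) F i) = \sum_(i <- r) d (F i).
Proof. by move=> hd; apply: (big_morph d hd.1); exact: derivation0. Qed.

Lemma derivation_fgen d (P : E -> Prop) : is_derivation d -> (forall x, P x -> d x = 0) ->
  forall x, fgen P x -> d x = 0.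
Proof.
move=> hd dP; apply: fgen_min => //.
  split=> [|x y dx dy|x y dx dy]; first exact: derivation1.
    by rewrite hd.1 derivationN // dx dy subrr.
  by rewrite hd.2 dx dy mul0r mulr0 addr0.
by move=> x dx; rewrite derivationV // dx oppr0 mul0r.
Qed.
End DerComb.

Section Dual.
Variables (E : fieldType) (P : E -> Prop) (y : seq E).
Hypothesis gen : forall x, fgen (fun x => P x \/ x \in y) x.

Record dual_system (e : nat) (u : nat -> E) (Delta : nat -> E -> E) : Prop := DualSystem {
  dual_der : forall i, is_derivation (Delta i);
  dual_triv : forall i x, P x -> Delta i x = 0;
  dual_pair : forall i k, (i < e)%N -> (k < e)%N -> Delta i (u k) = (i == k)%:R }.

(** Take a dual system of maximal length with [u] in [y]. A derivation that kills [P] and all [u k]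
    but moves some [t] in [y] would lengthen it. *)
Lemma ex_dual_system : exists e u Delta, dual_system e u Delta /\
  forall d, is_derivation d -> (forall x, P x -> d x = 0) ->
    (forall k, (k < e)%N -> d (u k) = 0) -> forall x, d x = 0.
Proof.
pose good e := exists u Delta, dual_system e u Delta /\ forall k, (k < e)%N -> u k \in y.
have good0 : good 0%N.
  exists (fun=> 0), (fun _ _ => 0); split=> //.
  by split=> // i; split=> *; rewrite ?mul0r ?mulr0 ?addr0.
have bound e : good e -> (e <= size y)%N.
  move=> [u [Delta [[_ _ pair] uy]]]; rewrite -(size_iota 0 e) -(size_map u).
  apply: uniq_leq_size => [|x /mapP[k]]; last by rewrite mem_iota => /andP[_ lt] ->; apply: uy.
  rewrite map_inj_in_uniq ?iota_uniq // => i k; rewrite !mem_iota /= => lti ltk euv.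
  apply/eqP/negPn/negP => ne; have := pair i k lti ltk.
  by rewrite -euv pair // eqxx (negPf ne) => /eqP; rewrite oner_eq0.
(* The largest [e] is obtained as the one with the least [size y - e]. *)
have [n [e ge en] nmin] : exists2 n, (exists2 e, good e & e = size y - n)%N &
    forall m, (exists2 e, good e & e = size y - m)%N -> (n <= m)%N.
  by apply: ex_minP; exists (size y); exists 0%N => //; rewrite subnn.
have emax : ~ good e.+1.
  move=> ge1; have := bound _ ge1 => le.
  have := nmin (size y - e.+1)%N (ex_intro2 _ _ e.+1 ge1 _); rewrite subKn // => /(_ erefl).
  by lia.
case: ge => u [Delta [[der triv pair] uy]]; exists e, u, Delta; split=> //.
move=> d hd dP du x; apply: NNPP => dx.
have [t ty dt] : exists2 t, t \in y & d t != 0.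
  apply: NNPP => nt; apply: dx; apply: derivation_fgen (gen x) => // z [|zy]; first exact: dP.
  by apply/eqP/negPn/negP => dz; apply: nt; exists z.
pose d0 x := (d t)^-1 * d x.
have hd0 : is_derivation d0 by apply: is_derivation_scale.
have d0t : d0 t = 1 by rewrite /d0 mulVf.
(* [d0] is dual to [t] and kills the old [u k]; subtracting a multiple of it makes each old
   [Delta i] vanish at [t]. *)
apply: emax; exists (fun k => if k == e then t else u k).
exists (fun i x => if i == e then d0 x else Delta i x - Delta i t * d0 x); split; last first.
  by move=> k lt; case: eqP => // ne; apply: uy; lia.
split=> [i|i z Pz|i k lti ltk].
- case: eqP => _ //; apply: is_derivation_sub => //; exact: is_derivation_scale.
- by case: eqP => _; rewrite /d0 (dP z Pz) ?(triv i z Pz) !mulr0 // subr0.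
have d0u m : (m < e)%N -> d0 (u m) = 0 by move=> lt; rewrite /d0 du // mulr0.
case: (eqVneq k e) => [->|ke].
  by case: (eqVneq i e) => [_|ie]; rewrite d0t ?mulr1 ?subrr.
have ke' : (k < e)%N by lia.
case: (eqVneq i e) => [->|ie]; first by rewrite d0u // eq_sym (negPf ke).
by rewrite d0u // mulr0 subr0 pair //; lia.
Qed.
End Dual.

Section ReplaceEntries.
Variables (E : fieldType) (e : nat) (S : E -> Prop) (T : 'M[E]_e -> 'M[E]_e).
Hypothesis TD : forall c t A, T (c + t *: A) = T c + t *: T A.
Hypothesis inf : forall q : {poly E}, q != 0 -> exists2 t, S t & q.[t] != 0.

(** Entries are moved into [S] one at a time: the determinant is a nonzero polynomial in each entry,
    and [S] contains a non-root. *)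
Lemma det_replace_entries c0 : \det (T c0) != 0 ->
  exists c : 'M[E]_e, (forall i k, S (c i k)) /\ \det (T c) != 0.
Proof.
move=> det0.
suff [c hc ?] : exists2 c : 'M[E]_e, (forall p, p \in enum {: 'I_e * 'I_e} -> S (c p.1 p.2)) &
    \det (T c) != 0.
  by exists c; split=> // i k; apply: (hc (i, k)); rewrite mem_enum.
elim: (enum _) => [|[i k] s [c hc dc]]; first by exists c0.
(* The determinant as a polynomial in the entry [(i, k)]; its value at the present entry is
   [\det (T c)]. *)
pose q := \det (map_mx polyC (T c) + ('X - (c i k)%:P) *: map_mx polyC (T (delta_mx i k))).
have qE t : q.[t] = \det (T (c + (t - c i k) *: delta_mx i k)).
  rewrite -[LHS]/(horner_eval t q) -det_map_mx TD; congr (\det _).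
  apply/matrixP => a b; by rewrite !mxE /= /horner_eval hornerD hornerM hornerXsubC !hornerC.
have q0 : q != 0.
  apply: contraNneq dc => q0; have := qE (c i k).
  by rewrite q0 horner0 subrr scale0r addr0 => <-.
have [t St qt] := inf q0.
exists (c + (t - c i k) *: delta_mx i k); last by rewrite -qE.
move=> [a b]; rewrite inE !mxE /=; have [[-> ->] _|ne /= ins] := eqVneq (a, b) (i, k).
  by rewrite !eqxx mulr1 addrC subrK.
rewrite -xpair_eqE (negPf ne) mulr0 addr0; exact: (hc (a, b)).
Qed.
End ReplaceEntries.

(** * Existence of a cyclic element *)

Section Cyclic.
Variables (K E : fieldType) (iota : {rmorphism K -> E}) (delta : K -> K) (D : E -> E).
Hypotheses (hdelta : is_derivation delta) (hD : is_derivation D).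
Hypothesis Diota : forall x, iota (delta x) = D (iota x).
Variables (e : nat) (u : nat -> E) (Delta : nat -> E -> E).
Hypothesis dual : dual_system (fun x => exists c, x = iota c) e u Delta.
Hypothesis triv : forall d, is_derivation d -> (forall x, (exists c, x = iota c) -> d x = 0) ->
    (forall k, (k < e)%N -> d (u k) = 0) -> forall x, d x = 0.

Let Delta_der := dual_der dual.

Lemma Delta_iota i c : Delta i (iota c) = 0.
Proof. by apply: (dual_triv dual); exists c. Qed.

Definition comm_mx : 'M[E]_e := \matrix_(j < e, i < e) Delta i (D (u j)).
Definition grad (x : E) : 'rV[E]_e := \row_(i < e) Delta i x.

(** The commutator of [Delta i] and [D] is a derivation that vanishes on [K], because [D] preserves
    [K]. Hence it is the combination of the [Delta j] read off at the [u j]. *)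
Lemma grad_der x : grad (D x) = map_mx D (grad x) + grad x *m comm_mx.
Proof.
apply/rowP => i; rewrite !mxE.
pose d x := (Delta i (D x) - D (Delta i x)) - \sum_(j < e) Delta i (D (u j)) * Delta j x.
have hd : is_derivation d.
  apply: is_derivation_sub; first exact: is_derivation_comm.
  by apply: is_derivation_sum => j; apply: is_derivation_scale.
have d0 : d x = 0.
  apply: triv hd _ _ x => [_ [c ->]|k lt].
    rewrite /d -Diota !Delta_iota derivation0 // subr0 big1 ?subr0 // => j _.
    by rewrite Delta_iota mulr0.
  have Db (b : bool) : D b%:R = 0 by case: b; rewrite ?derivation0 ?derivation1.
  rewrite /d (dual_pair dual) // Db subr0.
  rewrite (bigD1 (Ordinal lt)) //= big1 => [|j jk].
    by rewrite (dual_pair dual) // eqxx mulr1 addr0 subrr.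
  by rewrite (dual_pair dual) // -[k]/(val (Ordinal lt)) (inj_eq val_inj) (negPf jk) mulr0.
move/eqP: d0; rewrite /d subr_eq0 subr_eq addrC => /eqP ->; congr (_ + _).
by apply: eq_bigr => j _; rewrite !mxE mulrC.
Qed.

(** The coefficients, independent of [w], that express the gradient of [D^m (sum w_k u_k)] through
    the derivatives of the row [w]. The recursion is one application of [grad_der]. *)
Fixpoint jet_mx (m l : nat) : 'M[E]_e :=
  if m is m'.+1 then
    map_mx D (jet_mx m' l) + jet_mx m' l *m comm_mx + (if l is l'.+1 then jet_mx m' l' else 0)
  else if l is 0 then 1%:M else 0.

Lemma map_mx_der0 m n : map_mx D (0 : 'M[E]_(m, n)) = 0.
Proof. by apply/matrixP => i k; rewrite !mxE derivation0. Qed.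

Lemma jet_mx_gt m l : (m < l)%N -> jet_mx m l = 0.
Proof.
elim: m l => [|m IH] [|l] //= lt; rewrite !IH //; last by lia.
by rewrite map_mx_der0 mul0mx !addr0.
Qed.

Lemma jet_mx_diag m : jet_mx m m = 1%:M.
Proof. by elim: m => //= m IH; rewrite jet_mx_gt // map_mx_der0 mul0mx !add0r. Qed.

Definition wrow (w : nat -> K) l : 'rV[E]_e := \row_(k < e) iota (iter l delta (w k)).
Definition wcomb (w : nat -> K) : E := \sum_(k < e) iota (w k) * u k.

Lemma map_wrow w l : map_mx D (wrow w l) = wrow w l.+1.
Proof. by apply/rowP => k; rewrite !mxE -Diota. Qed.

Lemma map_mulmx_der m n p (A : 'M[E]_(m, n)) (B : 'M[E]_(n, p)) :
  map_mx D (A *m B) = map_mx D A *m B + A *m map_mx D B.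
Proof.
apply/matrixP => i k; rewrite !mxE derivation_sum // -big_split.
by apply: eq_bigr => l _; rewrite !mxE hD.2.
Qed.

Lemma map_sum_der m n (I : Type) (r : seq I) (F : I -> 'M[E]_(m, n)) :
  map_mx D (\sum_(i <- r) F i) = \sum_(i <- r) map_mx D (F i).
Proof.
apply: (big_morph (map_mx D)); last exact: map_mx_der0.
by move=> A B; apply/matrixP => i k; rewrite !mxE hD.1.
Qed.

Lemma grad_jet w m N : (m < N)%N ->
  grad (iter m D (wcomb w)) = \sum_(l < N) wrow w l *m jet_mx m l.
Proof.
elim: m N => [|m IH] [|N] // lt.
  rewrite big_ord_recl big1 ?addr0 ?mulmx1; last by move=> l _; rewrite /= mulmx0.
  apply/rowP => i; rewrite !mxE /wcomb derivation_sum // (bigD1 i) //= big1.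
    by rewrite (Delta_der i).2 Delta_iota (dual_pair dual) // eqxx mul0r add0r mulr1 addr0.
  move=> k ki; rewrite (Delta_der i).2 Delta_iota (dual_pair dual) // mul0r add0r.
  by rewrite [in LHS](inj_eq val_inj) eq_sym (negPf ki) mulr0.
rewrite iterS grad_der (IH N.+1) 1?ltnW // mulmx_suml map_sum_der -big_split /=.
under eq_bigr do rewrite map_mulmx_der map_wrow -mulmxA.
under [RHS]eq_bigr do rewrite !mulmxDr addrC.
rewrite !big_split /= -!addrA; congr (_ + _).
(* The shifted sums match after dropping the zero first term on the right and the last term on the
   left, which vanishes as [m < N]. *)
rewrite [RHS]big_ord_recl /= mulmx0 add0r.
by rewrite big_ord_recr /= (@jet_mx_gt m N) ?mulmx0 ?addr0.
Qed.

Hypothesis wronskian : exists z : nat -> K,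
  \det (\matrix_(l < e, i < e) iter l delta (z i)) != 0.
Hypothesis consts : forall q : {poly E}, q != 0 ->
  exists2 c, delta c = 0 & q.[iota c] != 0.

(** The gradients of the jets as a linear function of the derivatives of [w], the rows of [W] being
    treated as independent unknowns. *)
Definition jet_op (W : 'M[E]_e) : 'M[E]_e :=
  \matrix_(m < e) \sum_(l < e) row l W *m jet_mx m l.

(* [jet_op] is unitriangular in the rows. *)
Lemma jet_op_surj : exists W, jet_op W = 1%:M.
Proof.
suff [W hW] : exists W : nat -> 'rV[E]_e, forall m, (m < e)%N ->
    \sum_(l < e) W l *m jet_mx m l = \row_i (m == i)%:R.
  exists (\matrix_l W l); apply/row_matrixP => m.
  rewrite rowK; under eq_bigr do rewrite rowK.
  by rewrite hW //; apply/rowP => i; rewrite !mxE.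
suff H n : exists W : nat -> 'rV[E]_e, forall m, (m < n)%N ->
    \sum_(l < m.+1) W l *m jet_mx m l = \row_i (m == i)%:R.
  have [W hW] := H e; exists W => m lt; rewrite -hW //.
  rewrite [RHS](big_ord_widen e (fun l => W l *m jet_mx m l)) // [RHS]big_mkcond /=.
  by apply: eq_bigr => l _; case: ltnP => // gt; rewrite jet_mx_gt ?mulmx0.
elim: n => [|n [W hW]]; first by exists (fun=> 0).
exists (fun l => if l == n then \row_i (n == i)%:R - \sum_(l < n) W l *m jet_mx n l else W l).
move=> m; rewrite ltnS leq_eqVlt => /orP[/eqP ->|lt].
  rewrite big_ord_recr /= eqxx jet_mx_diag mulmx1.
  under eq_bigr => l _ do rewrite (ltn_eqF (ltn_ord l)).
  by rewrite addrC subrK.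
rewrite -hW //; apply: eq_bigr => l _.
by rewrite (ltn_eqF (leq_trans (ltn_ord l) lt)).
Qed.

Lemma iter_der_const l (c z : nat -> K) n : (forall i, delta (c i) = 0) ->
  iter l delta (\sum_(i < n) z i * c i) = \sum_(i < n) iter l delta (z i) * c i.
Proof.
move=> c0; elim: l => //= l ->; rewrite derivation_sum //.
by apply: eq_bigr => i _; rewrite hdelta.2 c0 mulr0 addr0.
Qed.

(** A solution [W0] of [jet_op W = 1] need not consist of successive derivatives of one row. Write
    it as [Z *m c] with [Z] an invertible Wronskian matrix and move the entries of [c] to constants
    of [K], keeping the determinant nonzero. For constant [c] the rows of [Z *m c] are the
    derivatives of [w_k = sum z_i c_ik]. *)
Lemma ex_cyclic : exists a, \det (\matrix_(m < e, i < e) Delta i (iter m D a)) != 0.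
Proof.
have [z wr] := wronskian; have [W0 hW0] := jet_op_surj.
pose Z : 'M[E]_e := \matrix_(l, i) iota (iter l delta (z i)).
have Zu : Z \in unitmx.
  rewrite unitmxE unitfE (_ : Z = map_mx iota (\matrix_(l < e, i < e) iter l delta (z i))).
    by rewrite det_map_mx fmorph_eq0.
  by apply/matrixP => l i; rewrite !mxE.
pose T c := jet_op (Z *m c).
have [|q q0||c [cS detc]] := @det_replace_entries E e (fun x => exists2 c, delta c = 0 & x = iota c)
    T _ _ (invmx Z *m W0).
- move=> c t A.
  have rowDZ l (B C : 'M[E]_e) : row l (B + t *: C) = row l B + t *: row l C.
    by apply/rowP => i; rewrite !mxE.
  apply/row_matrixP => m; rewrite rowDZ !rowK scaler_sumr -big_split.
  apply: eq_bigr => l _ /=.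
  by rewrite mulmxDr -scalemxAr rowDZ mulmxDl scalemxAl.
- by have [c c0 qc] := consts q0; exists (iota c) => //; exists c.
- by rewrite /T mulKVmx // hW0 det1 oner_neq0.
have /choice [cf cfE] : forall p : 'I_e * 'I_e, exists x, delta x = 0 /\ c p.1 p.2 = iota x.
  by move=> p; have [x x0 ->] := cS p.1 p.2; exists x.
(* The entries are extended to all natural indices by [0], which is again a constant. *)
pose co (i k : nat) : K := if (insub i, insub k) is (Some i', Some k') then cf (i', k') else 0.
have coE (i k : 'I_e) : co i k = cf (i, k) by rewrite /co !valK.
have co0 i k : delta (co i k) = 0.
  rewrite /co; case: insubP => [i' _ _|_]; last exact: derivation0.
  by case: insubP => [k' _ _|_]; [exact: (cfE _).1|exact: derivation0].
pose w k := \sum_(i < e) z i * co i k.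
exists (wcomb w); suff <- : T c = \matrix_(m < e, i < e) Delta i (iter m D (wcomb w)) by [].
apply/row_matrixP => m; rewrite rowK.
transitivity (grad (iter m D (wcomb w))); last by apply/rowP => i; rewrite !mxE.
rewrite (grad_jet w (ltn_ord m)); apply: eq_bigr => l _; congr (_ *m _).
apply/rowP => k; rewrite !mxE /w (iter_der_const l (c := fun i => co i k) z e) // rmorph_sum.
apply: eq_bigr => i _; rewrite !mxE rmorphM /= coE.
by rewrite (cfE (i, k)).2.
Qed.
End Cyclic.

(** * Algebraic independence from dual derivations *)

Lemma exprB_pchar (R : comNzRingType) p (x y : R) :
  p \in [pchar R] -> (x - y) ^+ p = x ^+ p - y ^+ p.
Proof. by move=> pR; rewrite -!(pFrobenius_autE pR) rmorphB. Qed.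

(** Induction on [n]. If the [c_i] are independent over the [p]-th powers of [K], separability makes
    all [x_i] vanish. Otherwise some [c_k] is a combination of the others with [p]-th powers as
    coefficients and is eliminated. *)
Lemma linear_relation_root (K L : fieldType) (iota : {rmorphism K -> L}) p :
  separable_ext iota -> p \in [pchar K] ->
  forall n (c : 'I_n -> K) (x : 'I_n -> L), (exists i, c i != 0) ->
  \sum_i iota (c i) * x i ^+ p = 0 ->
  exists b : 'I_n -> K, (exists i, b i != 0) /\ \sum_i iota (b i) * x i = 0.
Proof.
move=> sep pK; have pL : p \in [pchar L] by rewrite (fmorph_pchar iota).
have p0 : (0 < p)%N by apply: prime_gt0; exact: pcharf_prime pK.
elim=> [|n IH] c x [i0 ci0] rel; first by case: i0 ci0.
have [ind|dep] := classic (linearly_independent_over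
    (fun z : L => exists x : K, z = iota x ^+ p) (iota \o c)).
  have x0 i : x i ^+ p = 0.
    apply: (sep p pK n.+1 (iota \o c) _ ind (fun i => x i ^+ p)).
    - by move=> k; exists (c k).
    - by move=> k; exists (x k).
    - by rewrite -[RHS]rel; apply: eq_bigr => k _; rewrite mulrC.
  exists (fun=> 1); split; first by exists i0; rewrite oner_neq0.
  by rewrite big1 // => i _; move/eqP: (x0 i); rewrite expf_eq0 p0 => /eqP ->; rewrite mulr0.
have [d [[k dk] drel]] : exists d : 'I_n.+1 -> K, (exists k, d k != 0) /\
    \sum_i d i ^+ p * c i = 0.
  apply: NNPP => nd; apply: dep => f hf rel0 i.
  have [d df] := choice _ hf.
  rewrite df; apply/eqP; rewrite expf_eq0 p0 fmorph_eq0 /=; apply/negPn/negP => di.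
  apply: nd; exists d; split; first by exists i.
  apply: (fmorph_inj iota); rewrite rmorph0 -[RHS]rel0 rmorph_sum; apply: eq_bigr => l _ /=.
  by rewrite rmorphM rmorphXn df.
have [r ck] : exists r, c k = - \sum_i r i ^+ p * c (lift k i).
  exists (fun i => d (lift k i) / d k).
  move: drel; rewrite (bigD1_ord k) //= => /eqP; rewrite addr_eq0 => /eqP e.
  have dkp : d k ^+ p != 0 by rewrite expf_neq0.
  apply: (mulfI dkp); rewrite e mulrN mulr_sumr; congr (- _); apply: eq_bigr => i _.
  by rewrite mulrA -exprMn [d k * _]mulrC divfK.
(* After the elimination the relation concerns the [p]-th powers of [x_i - r_i x_k]. *)
have [||b [[i1 bi1] brel]] := IH (c \o lift k) (fun i => x (lift k i) - iota (r i) * x k).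
- apply: NNPP => nc; move/eqP: ci0; apply.
  have c0 i : c (lift k i) = 0.
    by apply/eqP/negPn/negP => ci; apply: nc; exists i.
  case: (unliftP k i0) => [i ->|->]; first exact: c0.
  by rewrite ck big1 ?oppr0 // => i _; rewrite c0 mulr0.
- rewrite -[RHS]rel [RHS](bigD1_ord k) //= ck rmorphN rmorph_sum mulNr mulr_suml -sumrN -big_split /=.
  apply: eq_bigr => i _.
  by rewrite exprB_pchar // exprMn rmorphM rmorphXn /=; ring.
exists (fun i => if unlift k i is Some i' then b i' else - \sum_i b i * r i); split.
  by exists (lift k i1); rewrite liftK.
rewrite (bigD1_ord k) //= unlift_none -[RHS]brel rmorphN rmorph_sum mulNr mulr_suml.
rewrite -sumrN -big_split; apply: eq_bigr => i _ /=; rewrite liftK rmorphM /=; ring.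
Qed.

Section Monomials.
Implicit Types m : {cmonom nat}.

(** The [p]-th root of [m] when [p] divides all its exponents. *)
Definition divcm_nat m p : {cmonom nat} := mkcmonom [fsfun i in finsupp m => (m i %/ p)%N].

Lemma divcm_natE m p i : divcm_nat m p i = (m i %/ p)%N.
Proof.
rewrite /divcm_nat cmE fsfunE; case: ifP => // /negbT.
by rewrite -cmE_eq0 => /eqP ->; rewrite div0n.
Qed.

Lemma monev_divcm_nat (R : comNzRingType) (z : nat -> R) m p : (forall i, (p %| m i)%N) ->
  monev z (divcm_nat m p) ^+ p = monev z m.
Proof.
move=> pm; rewrite (@monevEw _ _ (finsupp m)) => [|]; last first.
  apply/fsubsetP => i; rewrite -!cmE_neq0 divcm_natE; apply: contra_neq => ->.
  by rewrite div0n.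
by rewrite -prodrXl; apply: eq_bigr => i _; rewrite divcm_natE -exprM divnK.
Qed.

Lemma mdeg_divcm_nat m p : (1 < p)%N -> m != mone -> (forall i, (p %| m i)%N) ->
  (mdeg (divcm_nat m p) < mdeg m)%N.
Proof.
move=> p1 m1 pm; rewrite [X in (X < _)%N](@mdegEw _ _ (finsupp m)); last first.
  apply/fsubsetP => i; rewrite -!cmE_neq0 divcm_natE; apply: contra_neq => ->.
  by rewrite div0n.
have [j mj _] := mdegS m1; have jm : j \in finsupp m by rewrite -cmE_neq0 -lt0n.
rewrite mdegE !(big_fsetD1 j jm) /= -addSn leq_add //.
  by rewrite divcm_natE ltn_Pdiv.
by apply: leq_sum => i _; rewrite divcm_natE leq_div.
Qed.
End Monomials.

Section AlgIndep.
Variables (K E : fieldType) (iota : {rmorphism K -> E}).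
Implicit Types (P Q : dpoly K).

Lemma vars_lt_supp n Q m j : vars_lt n Q -> m \in msupp Q -> (n <= j)%N -> m j = 0%N.
Proof.
move=> [hQ] mQ nj; apply/eqP; rewrite -leqn0 leqNgt; apply/negP => mj.
have : doccurs j Q by apply/hasP; exists m.
by move/hQ; rewrite ltnNge nj.
Qed.

Lemma vars_lt_dpartial n j Q : vars_lt n Q -> vars_lt n (dpartial j Q).
Proof.
move=> [hQ]; constructor => i /hasP[m]; rewrite -mcoeff_neq0 mcoeff_dpartial => ne mi.
apply: hQ; apply/hasP; exists (mmul m (ucm j)); last by rewrite cmM addn_gt0 mi.
by rewrite -mcoeff_neq0; apply: contra_neq ne => ->; rewrite mul0rn.
Qed.

Lemma msize_lt Q n : (forall m, m \in msupp Q -> (mdeg m < n)%N) -> (msize Q <= n)%N.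
Proof. by move=> h; rewrite msizeE; apply/bigmax_leqP_seq => m /h. Qed.

Lemma msize_dpartial j Q : Q != 0 -> (msize (dpartial j Q) < msize Q)%N.
Proof.
move=> Q0; have : (0 < msize Q)%N by rewrite lt0n msize_eq0.
case e: (msize Q) => [//|n] _; rewrite ltnS; apply: msize_lt => m.
rewrite -mcoeff_neq0 mcoeff_dpartial => ne.
have /msize_mdeg_lt : mmul m (ucm j) \in msupp Q.
  by rewrite -mcoeff_neq0; apply: contra_neq ne => ->; rewrite mul0rn.
by rewrite e mdegM mdegU addn1 ltnS.
Qed.

Lemma pev_dpartialM a m P Q : pev iota a (dpartial m (P * Q)) =
  pev iota a (dpartial m P) * pev iota a Q + pev iota a P * pev iota a (dpartial m Q).
Proof.
apply: (etrans (congr1 (pev iota a) (dpartialM m P Q))).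
apply: (etrans (rmorphD (pev iota a) _ _)); apply: (congr2 +%R).
  exact: (rmorphM (pev iota a)).
exact: (rmorphM (pev iota a)).
Qed.

Lemma pev_dpartialD a m P Q : pev iota a (dpartial m (P + Q)) =
  pev iota a (dpartial m P) + pev iota a (dpartial m Q).
Proof.
apply: (etrans (congr1 (pev iota a) (dpartialD m P Q))).
exact: (rmorphD (pev iota a)).
Qed.

Lemma derivation_pev (d : E -> E) a n Q : is_derivation d -> (forall c, d (iota c) = 0) ->
  vars_lt n Q ->
  d (pev iota a Q) = \sum_(m < n) pev iota a (dpartial m Q) * d (a m).
Proof.
move=> hd dK [hQ].
have distr (x1 x2 x3 x4 x5 : E) : (x1 * x2 + x3 * x4) * x5 = x1 * x5 * x2 + x3 * (x4 * x5).
  by ring.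
apply: (dpoly_ind_occ (G := fun Q => d (pev iota a Q) =
   \sum_(m < n) pev iota a (dpartial m Q) * d (a m))).
- by move=> c; rewrite pevC dK big1 // => m _; rewrite dpartialC rmorph0 mul0r.
- move=> P1 P2 h1 h2; rewrite rmorphD hd.1 h1 h2 -big_split; apply: eq_bigr => m _ /=.
  by apply: esym; exact: (etrans (congr1 (fun x => x * d (a m)) (pev_dpartialD a m P1 P2)) (mulrDl _ _ _)).
- move=> P1 P2 h1 h2; rewrite rmorphM hd.2 h1 h2 mulr_suml mulr_sumr -big_split.
  apply: eq_bigr => m _ /=; apply: esym; apply: (etrans (congr1 (fun x => x * d (a m)) (pev_dpartialM a m P1 P2))).
  exact: distr.
- move=> j /hQ lt; rewrite pevX (bigD1 (Ordinal lt)) //= dpartialX eqxx rmorph1 mul1r.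
  rewrite big1 ?addr0 // => i ij; rewrite dpartialX eq_sym.
  by rewrite -[j]/(val (Ordinal lt)) (inj_eq val_inj) (negPf ij) rmorph0 mul0r.
Qed.

Variables (e : nat) (Delta : nat -> E -> E) (a : nat -> E).
Hypothesis sep : separable_ext iota.
Hypothesis Delta_der : forall i, is_derivation (Delta i).
Hypothesis Delta_iota : forall i c, Delta i (iota c) = 0.
Hypothesis detD : \det (\matrix_(m < e, i < e) Delta i (a m)) != 0.

(* A nonzero relation of minimal degree has vanishing partial derivatives, so it is
   a polynomial in [p]-th powers of the variables; [linear_relation_root] then
   yields a relation of smaller degree. *)
Lemma alg_indep Q : vars_lt e Q -> pev iota a Q = 0 -> Q = 0.
Proof.
move=> vQ aQ; apply/eqP; apply/negPn/negP => Q0.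
have [n {Q vQ aQ Q0} [Q [vQ aQ Q0 sQ]] min] := ex_minP (ex_intro (fun n => exists Q,
  [/\ vars_lt e Q, pev iota a Q = 0, Q != 0 & msize Q = n]) _
  (ex_intro _ Q (And4 vQ aQ Q0 erefl))).
have small Q' : vars_lt e Q' -> pev iota a Q' = 0 -> (msize Q' < msize Q)%N -> Q' = 0.
  move=> v' a' lt; apply/eqP; apply/negPn/negP => Q'0.
  by have := min (msize Q'); rewrite -sQ leqNgt lt => h; have // := h (ex_intro _ Q' (And4 v' a' Q'0 erefl)).
have dQ0 j : (j < e)%N -> dpartial j Q = 0.
  move=> lt; apply: small; [exact: vars_lt_dpartial| |exact: msize_dpartial].
  (* Applying every [Delta i] to the relation gives a homogeneous system with invertible matrix [M]
     for the values of the partial derivatives. *)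
  pose M := \matrix_(m < e, i < e) Delta i (a m).
  pose v := \row_(m < e) pev iota a (dpartial m Q).
  have vM : v *m M = 0.
    apply/rowP => i; rewrite !mxE; under eq_bigr do rewrite !mxE.
    rewrite -(derivation_pev a (Delta_der i)) // aQ; exact: derivation0.
  have Mu : M \in unitmx by rewrite unitmxE unitfE.
  have : v = 0 by rewrite -[v](mulmxK Mu) vM mul0mx.
  by move/rowP/(_ (Ordinal lt)); rewrite !mxE.
have natr0 m j : m \in msupp Q -> (m j)%:R = 0 :> K.
  move=> mQ; have [lt|ge] := ltnP j e; last by rewrite (vars_lt_supp vQ mQ ge).
  have [->//|mj] := posnP (m j).
  have := mcoeff_dpartial j Q (divcm m (ucm j)); rewrite dQ0 // mcoeff0.
  have -> : mmul (divcm m (ucm j)) (ucm j) = m.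
    apply/eqP/cmP => i; rewrite cmM divcmE cmU; case: eqP => [<-|_]; lia.
  rewrite divcmE cmUU subn1 prednK // => /esym e0.
  have : mcoeff m Q * (m j)%:R == 0 by rewrite mulr_natr e0.
  by rewrite mulf_eq0 mcoeff_eq0 mQ => /eqP.
have [m0 m0Q m01] : exists2 m, m \in msupp Q & m != mone.
  apply: NNPP => h; have eQ : Q = malgC (mcoeff mone Q).
    apply/malgP => m; rewrite mcoeffC; case: eqVneq => [->|m1]; first by rewrite mulr1n.
    by rewrite mulr0n; apply: mcoeff_outdom; apply/negP => mQ; apply: h; exists m.
  move: aQ Q0; rewrite eQ pevC => /eqP; rewrite fmorph_eq0 => /eqP ->.
  by rewrite malgC0E eqxx.
have [j0 mj0 _] := mdegS m01.
(* A positive exponent vanishes in [K], so the characteristic is positive. *)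
have [p pK] : exists p, p \in [pchar K] by apply: natf0_pchar mj0 _; rewrite natr0.
have pm m j : m \in msupp Q -> (p %| m j)%N by move=> mQ; rewrite (dvdn_pcharf pK) natr0.
have p1 : (1 < p)%N by apply: prime_gt1; exact: pcharf_prime pK.
pose s : seq {cmonom nat} := msupp Q.
have us : uniq s := fset_uniq _.
pose mu (i : 'I_(size s)) := nth mone s i.
have muQ i : mu i \in msupp Q by apply: mem_nth.
pose nu i := divcm_nat (mu i) p.
have nuI : injective nu.
  move=> i k enu; apply/val_inj/eqP; rewrite -(nth_uniq mone (ltn_ord i) (ltn_ord k) us).
  apply/cmP => l; have := congr1 (fun m : {cmonom nat} => m l) enu; rewrite /= !divcm_natE => el.
  by rewrite -(divnK (pm _ l (muQ i))) el divnK // pm // muQ.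
have [||b [[i1 bi1] brel]] := linear_relation_root sep pK
    (c := fun i : 'I_(size s) => mcoeff (mu i) Q) (x := fun i => monev a (nu i)).
- have m0s : (index m0 s < size s)%N by rewrite index_mem.
  by exists (Ordinal m0s); rewrite mcoeff_neq0 /mu /= nth_index.
- rewrite -[RHS]aQ pevE (big_nth mone) big_mkord; apply: eq_bigr => i _.
  by rewrite monev_divcm_nat // => l; apply: pm (muQ i).
(* The smaller relation: each monomial is replaced by its [p]-th root, with the coefficients found
   by [linear_relation_root]. *)
pose Q' : dpoly K := \sum_(i < size s) mkmalgU (nu i) (b i).
have cQ' m : mcoeff m Q' = \sum_(i < size s) b i *+ (nu i == m).
  by rewrite /Q' raddf_sum; apply: eq_bigr => i _ /=; rewrite mcoeffU.
have sQ' m : m \in msupp Q' -> exists i, m = nu i.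
  move=> mQ; apply: NNPP => nm; move: mQ; rewrite -mcoeff_neq0 cQ' big1 ?eqxx // => i _.
  by case: eqP => // e1; case: nm; exists i.
suff Q'0 : Q' = 0.
  have := cQ' (nu i1); rewrite Q'0 mcoeff0 (bigD1 i1) //= eqxx mulr1n big1 ?addr0.
    by move=> e0; rewrite -e0 eqxx in bi1.
  by move=> i ii; rewrite (inj_eq nuI) (negPf ii).
apply: small.
- constructor=> j /hasP[m /sQ'[i ->]]; rewrite divcm_natE => nj.
  rewrite ltnNge; apply/negP => ge.
  by rewrite (vars_lt_supp vQ (muQ i) ge) div0n in nj.
- by rewrite /Q' raddf_sum -[RHS]brel; apply: eq_bigr => i _; exact: pevU.
have lt0 : (mdeg m0 < msize Q)%N by apply: msize_mdeg_lt.
have : (0 < mdeg m0)%N by rewrite lt0n mdeg_eq0.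
move: lt0; case: (msize Q) (fun m => @msize_mdeg_lt _ _ Q m) => // N hN lt0 pos0.
rewrite ltnS; apply: msize_lt => m /sQ'[i ->].
(* The monomial [1] is its own root; there the drop in degree comes from [m0], whose degree is
   positive. *)
have [e1|n1] := eqVneq (mu i) mone.
  rewrite (_ : nu i = mone) ?mdeg1; first by lia.
  by apply/eqP/cmP => l; rewrite divcm_natE e1 cm1 div0n.
apply: leq_trans (mdeg_divcm_nat p1 n1 _) _; first by move=> l; exact: pm.
by have := hN _ (muQ i); rewrite ltnS.
Qed.
End AlgIndep.

(** * Consequences of differential solvability *)

Definition diff_solvable (K : fieldType) (delta : K -> K) : Prop :=
  forall f g : dpoly K,
     f <> 0 -> g <> 0 -> ~ in_base f -> separant f <> 0 ->
     (forall j : nat, (dord f <= j)%N -> ~~ doccurs j g) ->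
     exists a : K, deval delta f a = 0 /\ deval delta g a <> 0.

Definition jet (K : Type) (delta : K -> K) (x : K) (j : nat) : K := iter j delta x.

Lemma vars_lt0 (K : fieldType) n : vars_lt n (0 : dpoly K).
Proof. by rewrite -malgC0E; exact: vars_ltC. Qed.

Section Solvable.
Variables (K : fieldType) (delta : K -> K).
Hypotheses (hdelta : is_derivation delta) (solv : diff_solvable delta).

(** Condition (2) for [f = q(x_n)], in the form in which it is used below. *)
Lemma solvable_poly n (q : {poly dpoly K}) (g : dpoly K) :
  (forall i, vars_lt n q`_i) -> q^`() != 0 -> g != 0 -> vars_lt n g ->
  exists x, (map_poly (pev idfun (jet delta x)) q).[jet delta x n] = 0 /\
    pev idfun (jet delta x) g != 0.
Proof.
move=> vq q' g0 vg.
have dn0 := dpartial_horner_neq0 vq q'; have vf := vars_lt_horner vq.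
have on := dord_dpartial vf dn0; have oc := doccurs_dpartial dn0.
have [||||j|x] := solv (f := q.[dX n]) (g := g).
- by move=> f0; move/eqP: dn0; apply; rewrite f0; exact: dpartial0.
- exact/eqP.
- exact: in_base_doccurs oc.
- by rewrite /separant on; apply/eqP.
- by rewrite on => nj; exact: vars_ltE vg nj.
rewrite !deval_pev => -[fx gx]; exists x; split; last exact/eqP.
rewrite -[RHS]fx -[X in _ = X](horner_map (pev idfun (jet delta x)) q (dX n)).
by congr (_.[_]); rewrite /= pevX.
Qed.

Lemma pev_malgC_poly (z : nat -> K) (p : {poly K}) :
  map_poly (pev idfun z) (map_poly malgC p) = p.
Proof.
apply/polyP => i; rewrite coef_map_id0 ?rmorph0 // coef_map_id0 ?malgC0E //.
by rewrite pevC.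
Qed.

(** A polynomial over [K] is a differential polynomial of order [0], and coprimality with its
    derivative makes the separant nonzero. *)
Lemma solvable_separably_closed : separably_closed K.
Proof.
move=> p sp cop.
pose q : {poly dpoly K} := map_poly malgC p.
have cq i : q`_i = malgC p`_i by rewrite coef_map_id0 ?malgC0E.
have [||||x [qx _]] := @solvable_poly 0 q 1.
- by move=> i; rewrite cq; exact: vars_ltC.
- apply/eqP => q'0; have p'0 : p^`() = 0.
    apply/polyP => i; have /(congr1 (fun r : {poly dpoly K} => pev idfun (fun=> 0) r`_i)) := q'0.
    by rewrite /= !coef_deriv coef0 rmorph0 cq rmorphMn /= pevC coef0.
  move: cop; rewrite p'0 coprimep0 => /eqp_size; rewrite size_poly1 => e.
  by rewrite e in sp.
- exact: oner_neq0.
- exact: vars_ltC.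
by exists x; apply/rootP; rewrite -[RHS]qx pev_malgC_poly.
Qed.

(** Condition (2) with [f = x_(n+1)] and [g] the given linear form, of order [n]. *)
Lemma ex_linear_neq0 n (c : nat -> K) : c n != 0 ->
  exists x, \sum_(l < n.+1) c l * jet delta x l != 0.
Proof.
move=> cn; pose g : dpoly K := \sum_(l < n.+1) malgC (c l) * dX l.
have gE (z : nat -> K) : pev idfun z g = \sum_(l < n.+1) c l * z l.
  rewrite rmorph_sum; apply: eq_bigr => l _.
  exact: (etrans (rmorphM (pev idfun z) _ _) (congr2 *%R (pevC _ _ _) (pevX _ _ _))).
have [||||x [_ gx]] := @solvable_poly n.+1 'X g.
- move=> i; rewrite coefX; case: eqP => _; first exact: vars_ltC.
  exact: vars_lt0.
- by rewrite derivX oner_neq0.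
- apply: contraNneq cn => g0; have := gE (fun l => (l == n)%:R).
  rewrite g0 rmorph0 big_ord_recr /= eqxx mulr1 big1 ?add0r => [<-//|l _].
  by rewrite (ltn_eqF (ltn_ord l)) mulr0.
- by apply: vars_lt_sum => l; apply: vars_ltM; [exact: vars_ltC|exact: vars_ltX].
by exists x; rewrite -gE.
Qed.

(** Expanding along a new last column gives a linear form in the derivatives of [x], whose leading
    coefficient is the previous Wronskian. *)
Lemma ex_wronskian n : exists z : nat -> K,
  \det (\matrix_(l < n, i < n) iter l delta (z i)) != 0.
Proof.
elim: n => [|n [z hz]]; first by exists (fun=> 0); rewrite det_mx00 oner_neq0.
pose z' x i := if (i < n)%N then z i else x.
pose M x : 'M[K]_n.+1 := \matrix_(l, i) iter l delta (z' x i).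
(* Cofactors of the last column do not involve that column, so they can be computed with [x = 0]. *)
pose c l := if insub l is Some l' then cofactor (M 0) l' ord_max else 0.
have cof x l : cofactor (M x) l ord_max = c l.
  rewrite /c valK /cofactor; congr (_ * \det _); apply/matrixP => a b; rewrite !mxE.
  by rewrite /z' lift_max ltn_ord.
have [|x hx] := @ex_linear_neq0 n c.
  rewrite -(cof 0 ord_max) /cofactor mulf_eq0 negb_or signr_eq0 /=.
  apply: contraNneq hz => <-; apply/eqP; congr (\det _); apply/matrixP => a b.
  by rewrite !mxE /z' !lift_max ltn_ord.
exists (z' x); rewrite (expand_det_col _ ord_max).
rewrite (_ : \sum_(_ < _) _ = \sum_(l < n.+1) c l * jet delta x l) //.
by apply: eq_bigr => l _; rewrite cof !mxE /z' ltnn mulrC.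
Qed.

(** Condition (2) with [f = x_1] and [g] the product of the [x_0 - c] over the constants found so
    far yields a new one. *)
Lemma ex_consts n : exists s : seq K, [/\ uniq s, size s = n & forall x, x \in s -> delta x = 0].
Proof.
elim: n => [|n [s [us ss sc]]]; first by exists [::].
pose g : dpoly K := \prod_(c <- s) (dX 0 - malgC c).
have gE z : pev idfun z g = \prod_(c <- s) (z 0%N - c).
  rewrite rmorph_prod; apply: eq_bigr => c _.
  exact: (etrans (rmorphB (pev idfun z) _ _) (congr2 (fun x y => x - y) (pevX _ _ _) (pevC _ _ _))).
(* Substituting one indeterminate for all variables shows that [g] is nonzero. *)
have gEX : pev (@polyC K) (fun=> 'X) g = \prod_(c <- s) ('X - c%:P).
  rewrite rmorph_prod; apply: eq_bigr => c _.
  exact: (etrans (rmorphB (pev (@polyC K) (fun=> 'X)) _ _)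
    (congr2 (fun x y => x - y) (pevX _ _ _) (pevC _ _ _))).
have [||||x []] := @solvable_poly 1 'X g.
- move=> i; rewrite coefX; case: eqP => _; first exact: vars_ltC.
  exact: vars_lt0.
- by rewrite derivX oner_neq0.
- apply/eqP => g0; move: gEX; rewrite g0 rmorph0 => /esym/eqP.
  by rewrite (negPf (monic_neq0 (monic_prod_XsubC _ _ _))).
- rewrite /g; apply: (big_ind (vars_lt 1)); [exact: vars_ltC|exact: vars_ltM|move=> c _].
  by rewrite -monalgUN; apply: vars_ltD; [exact: vars_ltX|exact: vars_ltC].
rewrite map_polyX hornerX gE => x0 gx; exists (x :: s); split; rewrite /= ?ss //.
  rewrite us andbT; apply: contraNN gx => xs; rewrite (big_rem x) //= /jet /= subrr mul0r //.
by move=> y; rewrite inE => /orP[/eqP ->|/sc//].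
Qed.

Lemma ex_const_nonroot (E : fieldType) (iota : {rmorphism K -> E}) (q : {poly E}) :
  q != 0 -> exists2 c, delta c = 0 & q.[iota c] != 0.
Proof.
move=> q0; have [s [us ss sc]] := ex_consts (size q); apply: NNPP => nc.
have : (size (map iota s) < size q)%N.
  apply: max_poly_roots => //; last by rewrite map_inj_uniq //; exact: fmorph_inj.
  apply/allP => _ /mapP[c cs ->]; apply/negPn/negP => rc; apply: nc.
  by exists c => //; exact: sc.
by rewrite size_map ss ltnn.
Qed.
End Solvable.

(** * Differential specializations of finitely generated extensions *)

(** A partial differential morphism from [E] to [K], given as a relation; [dplaceB] and
    [dplace_neq0] together make it single-valued. *)
Record diff_place (K E : fieldType) (iota : {rmorphism K -> E}) (delta : K -> K)
    (D : E -> E) (R : E -> K -> Prop) : Prop := DiffPlace {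
  dplace_base : forall c, R (iota c) c;
  dplaceB : forall z z' c c', R z c -> R z' c' -> R (z - z') (c - c');
  dplaceM : forall z z' c c', R z c -> R z' c' -> R (z * z') (c * c');
  dplace_neq0 : forall z c, R z c -> c != 0 -> z != 0;
  dplace_der : forall z c, R z c -> R (D z) (delta c) }.

Section GenericSubring.
Variables (K E : fieldType) (iota : {rmorphism K -> E}) (e : nat) (a : nat -> E).

Lemma pev_subring : subring_prop (fun z => exists2 Q, vars_lt e Q & z = pev iota a Q).
Proof.
split.
- by exists 1; [exact: vars_ltC|rewrite rmorph1].
- move=> _ _ [P vP ->] [Q vQ ->]; exists (P + malgC (-1) * Q).
    by apply: vars_ltD => //; apply: vars_ltM => //; exact: vars_ltC.
  apply/esym; apply: (etrans (rmorphD (pev iota a) _ _)); congr (_ + _).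
  apply: (etrans (rmorphM (pev iota a) _ _)).
  by apply: (etrans (congr1 (fun x => x * _) (pevC _ _ _))); rewrite rmorphN1 mulN1r.
- move=> _ _ [P vP ->] [Q vQ ->]; exists (P * Q); first exact: vars_ltM.
  by apply/esym; exact: (rmorphM (pev iota a)).
Qed.

Hypothesis indep : forall Q, vars_lt e Q -> pev iota a Q = 0 -> Q = 0.

Lemma vars_ltB n (P Q : dpoly K) : vars_lt n P -> vars_lt n Q -> vars_lt n (P - Q).
Proof.
move=> vP vQ; apply: vars_ltD => //; rewrite -[- Q]mulN1r; apply: vars_ltM => //.
by rewrite -[1]/(malgC 1) -monalgUN; exact: vars_ltC.
Qed.

(** By independence, evaluation at [a] is injective on polynomials in the first [e] variables; [l]
    is its inverse on the image [A]. *)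
Lemma generic_subring : exists (A : idomainType) (j : {rmorphism A -> E})
    (l : {rmorphism A -> dpoly K}), [/\ injective j,
    forall x, (exists b, x = j b) <-> exists2 Q, vars_lt e Q & x = pev iota a Q,
    forall x, vars_lt e (l x), forall x, pev iota a (l x) = j x &
    forall x Q, vars_lt e Q -> j x = pev iota a Q -> l x = Q].
Proof.
have [A [j [jI jP]]] := subring_pack pev_subring.
have hQ x : exists Q, vars_lt e Q /\ j x = pev iota a Q.
  have /jP[Q vQ eQ] : exists b, j x = j b by exists x.
  by exists Q.
have [f fE] := choice _ hQ.
have fU x Q : vars_lt e Q -> j x = pev iota a Q -> f x = Q.
  move=> vQ eQ; apply/eqP; rewrite -subr_eq0; apply/eqP/indep.
    by apply: vars_ltB => //; exact: (fE x).1.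
  apply: (etrans (rmorphB (pev iota a) _ _)).
  exact: (etrans (congr2 (fun x y => x - y) (esym (fE x).2) (esym eQ)) (subrr _)).
have [||l lE] := @rmorph_pack A (dpoly K) f.
- move=> x y; apply: fU; first by apply: vars_ltB; exact: (fE _).1.
  by rewrite rmorphB (fE x).2 (fE y).2; apply/esym; exact: (rmorphB (pev iota a)).
- split=> [|x y]; apply: fU; first exact: vars_ltC.
  + by rewrite rmorph1; apply/esym; exact: (rmorph1 (pev iota a)).
  + by apply: vars_ltM; exact: (fE _).1.
  by rewrite rmorphM (fE x).2 (fE y).2; apply/esym; exact: (rmorphM (pev iota a)).
exists A, j, l; split=> //.
- by move=> x; split=> /jP.
- by move=> x; rewrite lE; exact: (fE x).1.
- by move=> x; rewrite lE (fE x).2.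
- by move=> x Q vQ eQ; rewrite lE; apply: fU.
Qed.
End GenericSubring.

Section Specialization.
Variables (K E : fieldType) (iota : {rmorphism K -> E}) (delta : K -> K) (D : E -> E).
Hypotheses (hdelta : is_derivation delta) (solv : diff_solvable delta).
Hypotheses (hD : is_derivation D) (Diota : forall x, iota (delta x) = D (iota x)).
Hypothesis sep : separable_ext iota.
Variable y : seq E.
Hypothesis gen : forall x, fgen (fun x => (exists c, x = iota c) \/ x \in y) x.

(** The jets of a cyclic element are independent by [alg_indep], and [derivation_tower] makes [E]
    separable over them. The tower begins with [a e], so that its equation over the previous jets is
    available. *)
Lemma ex_generic_jet : exists e (a : nat -> E), [/\
  forall m, D (a m) = a m.+1,
  forall Q, vars_lt e Q -> pev iota a Q = 0 -> Q = 0 &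
  tower (fun z => exists2 Q, vars_lt e Q & z = pev iota a Q) (a e :: y)].
Proof.
have [e [u [Delta [dual triv]]]] := ex_dual_system gen.
have [a0 det0] := ex_cyclic hdelta hD Diota dual triv (ex_wronskian solv e)
  (ex_const_nonroot solv iota).
pose a m := iter m D a0; exists e, a; split=> //.
  apply: (alg_indep sep (dual_der dual) _ det0) => i c.
  by apply: (dual_triv dual); exists c.
apply: (proj1 (derivation_tower _ _)).
  move=> x; apply: fgen_sub (gen x) => z [[c ->]|zy]; last by right; rewrite inE zy orbT.
  by left; exists (malgC c); [exact: vars_ltC|rewrite pevC].
move=> d hd dP.
have dK c : d (iota c) = 0.
  by apply: dP; exists (malgC c); [exact: vars_ltC|rewrite pevC].
have da m : (m < e)%N -> d (a m) = 0.
  by move=> lt; apply: dP; exists (dX m); [exact: vars_ltX|rewrite pevX].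
(* A derivation that kills [K] is a combination of the [Delta i]. If it also kills the first [e]
   jets, the invertible jet matrix forces its coefficients to be zero. *)
have dE x : d x = \sum_(i < e) d (u i) * Delta i x.
  apply/eqP; rewrite -subr_eq0; apply/eqP.
  pose d' x := d x - \sum_(i < e) d (u i) * Delta i x.
  apply: (triv d') => [|_ [c ->]|k lt].
  - apply: is_derivation_sub => //; apply: is_derivation_sum => i.
    by apply: is_derivation_scale; exact: (dual_der dual).
  - rewrite /d' dK big1 ?subr0 // => i _; rewrite (dual_triv dual) ?mulr0 //.
    by exists c.
  rewrite /d' (bigD1 (Ordinal lt)) //= (dual_pair dual) // eqxx mulr1 big1 ?addr0 ?subrr //.
  move=> i ik; rewrite (dual_pair dual) // -[k]/(val (Ordinal lt)) (inj_eq val_inj).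
  by rewrite (negPf ik) mulr0.
pose M := \matrix_(m < e, i < e) Delta i (iter m D a0).
have Mu : M^T \in unitmx by rewrite unitmx_tr unitmxE unitfE.
have v0 : \row_(i < e) d (u i) = 0.
  rewrite -[LHS](mulmxK Mu) (_ : _ *m M^T = 0) ?mul0mx //.
  apply/rowP => m; rewrite !mxE -[RHS](da m) // dE; apply: eq_bigr => i _.
  by rewrite !mxE.
move=> x; rewrite dE big1 // => i _; move/rowP/(_ i): v0; rewrite !mxE => ->.
by rewrite mul0r.
Qed.

(** The domains are [A = K[a_0, ..., a_(e-1)]], then [A1 = A[a_e]], then [B] at the top of the
    tower. Condition (2) supplies the morphism on [A] and the root for [a_e]; [tower_specialize]
    does the rest. *)
Lemma specialization (S : seq E) : exists R, diff_place iota delta D R /\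
  forall z, z \in S -> exists c, R z c.
Proof.
have [e [a [Da indep [sepa tow]]]] := ex_generic_jet.
have [A [j [l [jI jP lv lE lU]]]] := generic_subring indep.
have sc := solvable_separably_closed solv.
have jsub x : (exists2 Q, vars_lt e Q & x = pev iota a Q) -> exists b, x = j b by move/jP.
have [p [pa p'a]] : exists p : {poly A}, ev_at j (a e) p = 0 /\ ev_at j (a e) p^`() != 0.
  apply: sepalg_lift => //; case: sepa => p [pF pa p'a]; exists p; split=> // i.
  by apply: fgen_sub (pF i); exact: jsub.
have [A1 [j1 [j1I j1P ext]]] := simple_ext jI pa p'a.
have jj1 x : exists b, j x = j1 b by apply/j1P; exists x%:P; rewrite ev_atC.
have tow1 : tower (fun x => exists b, x = j1 b) y.
  apply: tower_sub tow => x [/jsub[b ->]|->]; first exact: jj1.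
  by apply/j1P; exists 'X; rewrite ev_atX.
have [B [k [b0 [kI j1k yk b00 [good comp]]]]] := tower_specialize hD hdelta sc j1I tow1.
have jk x : exists b, j x = k b by have [b ->] := jj1 x; exact: j1k.
have Kj c : exists b, iota c = j b.
  by apply: jsub; exists (malgC c); [exact: vars_ltC|rewrite pevC].
have aj m : (m < e)%N -> exists b, a m = j b.
  by move=> lt; apply: jsub; exists (dX m); [exact: vars_ltX|rewrite pevX].
have [xe exe] : exists b, a e = k b.
  have [b ->] : exists b, a e = j1 b by apply/j1P; exists 'X; rewrite ev_atX.
  exact: j1k.
have lift q : exists q' : {poly B}, map_poly j q = map_poly k q'.
  apply: (map_poly_lift (F := fun x => exists b, x = k b)) => // i.
  by rewrite coef_map; exact: jk.
have evk q q' : map_poly j q = map_poly k q' -> ev_at j (a e) q = k q'.[xe].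
  by move=> eq; rewrite /ev_at eq exe horner_map.
have [p1 ep1] := lift p.
have p1' : p1^`().[xe] != 0.
  apply: contraNneq p'a => z0; rewrite (evk _ p1^`()) ?z0 ?rmorph0 //.
  by rewrite -!deriv_map ep1.
have [|den den0 denS] := @frac_of_common _ _ k S kI.
  move=> x _; apply: fgen_frac_of (gen x) => z [[c ->]|/yk//].
  by have [b ->] := Kj c; exact: jk.
(* The three factors protect compatibility along the tower, the denominators of [S], and the
   simplicity of the root [a e]. *)
have [|g1 g10 hg1] := good (b0 * den * p1^`().[xe]); first by rewrite !mulf_neq0.
have [m [g [g0 m'0 hg]]] := ext K g1 g10.
have lI x : l x = 0 -> x = 0.
  by move=> lx; apply: jI; rewrite rmorph0 -lE lx; exact: (rmorph0 (pev iota a)).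
have [||||alpha [malpha galpha]] := solvable_poly solv (n := e) (q := map_poly l m) (g := l g).
- by move=> i; rewrite coef_map; exact: lv.
- apply: contraNneq m'0 => q'0; apply/eqP/polyP => i; rewrite coef0; apply: lI.
  have := congr1 (fun r : {poly dpoly K} => r`_i) q'0.
  by rewrite deriv_map coef_map coef0.
- by apply: contraNneq g0 => lg; apply/eqP/lI.
- exact: lv.
pose z := jet delta alpha.
(* [a m] goes to the [m]-th derivative of [alpha], for [m < e] through [psi], and for [m = e] by
   choosing [z e] as the root. *)
pose psi : {rmorphism A -> K} := pev idfun z \o l.
have [|_ _ rootE] := hg psi; first exact: galpha.
have [|psi1 [psi1g psi1E]] := rootE (z e).
  by apply/rootP; rewrite -[RHS]malpha -map_poly_comp.
have [psi' []] := hg1 psi1 psi1g.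
rewrite !rmorphM !mulf_eq0 !negb_or => /andP[/andP[pb0 pden] pp1] psi'E.
have psiE b x : j b = k x -> psi' x = psi b.
  move=> ebx; have [b1 eb1] := jj1 b; rewrite -(psi'E b1) -?eb1 //.
  by rewrite (psi1E b%:P) ?ev_atC // map_polyC hornerC.
have psi'xe : psi' xe = z e.
  have [b1 eb1] : exists b, a e = j1 b by apply/j1P; exists 'X; rewrite ev_atX.
  by rewrite -(psi'E b1) -?eb1 ?exe // (psi1E 'X) ?ev_atX ?map_polyX ?hornerX.
have psi'K c x : iota c = k x -> psi' x = c.
  have [b eb] := Kj c; rewrite eb => /psiE ->; rewrite /psi /= (lU b (malgC c)) ?pevC //.
  exact: vars_ltC.
have psi'a i x : (i <= e)%N -> a i = k x -> psi' x = z i.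
  rewrite leq_eqVlt => /orP[/eqP ->|lt eax].
    by rewrite exe => /kI <-.
  have [b eb] := aj i lt; rewrite (psiE b) -?eb // /psi /= (lU b (dX i)) ?pevX //.
  exact: vars_ltX.
have kx c : exists x, iota c = k x by have [b ->] := Kj c; exact: jk.
have ka i : (i <= e)%N -> exists x, a i = k x.
  rewrite leq_eqVlt => /orP[/eqP ->|lt]; first by exists xe.
  by have [b ->] := aj i lt; exact: jk.
pose C w := exists2 x, w = k x & compat k psi' D delta x.
have CK c : C (iota c).
  have [x ex] := kx c; exists x => //; rewrite /compat -ex -Diota (psi'K c) //.
  have [x' ex'] := kx (delta c); rewrite ex' -(psi'K _ _ ex'); exact: place_base.
(* Since [i < e], the derivative [a i.+1] still has a prescribed image, namely [z i.+1]. *)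
have Ca i : (i < e)%N -> C (a i).
  move=> lt; have [x ex] := ka i (ltnW lt); exists x => //; rewrite /compat -ex Da.
  rewrite (psi'a i) ?(ltnW lt) //; have [x' ex'] := ka i.+1 lt.
  have ez : delta (z i) = psi' x' by rewrite (psi'a i.+1).
  by rewrite ex' ez; exact: place_base.
have CD w w' : C w -> C w' -> C (w + w').
  by move=> [x -> cx] [x' -> cx']; exists (x + x'); [rewrite rmorphD|exact: compatD].
have CM w w' : C w -> C w' -> C (w * w').
  by move=> [x -> cx] [x' -> cx']; exists (x * x'); [rewrite rmorphM|exact: compatM].
have Cj b x : j b = k x -> compat k psi' D delta x.
  move=> ebx; suff [x' ex' cx'] : C (j b) by rewrite (kI x x') // -ebx -ex'.
  rewrite -lE; have [vb] := lv b.
  apply: (dpoly_ind_occ (G := fun Q => C (pev iota a Q))).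
  - by move=> c; rewrite pevC.
  - by move=> P Q CP CQ; rewrite rmorphD; exact: CD.
  - by move=> P Q CP CQ; rewrite rmorphM; exact: CM.
  - by move=> i /vb lt; rewrite pevX; exact: Ca.
have coefc q1 q2 i : map_poly j q1 = map_poly k q2 -> compat k psi' D delta q2`_i.
  by move=> e12; apply: (Cj q1`_i); rewrite -!coef_map e12.
(* The image of the next jet [a e.+1] is not prescribed; the equation of [a e] determines the
   derivative on both sides. *)
have cxe : compat k psi' D delta xe.
  apply: (compat_root kI hD hdelta (q := p1)) => // [i|]; first exact: coefc ep1.
  by apply: kI; rewrite -(evk p) // pa rmorph0.
have call : forall x, compat k psi' D delta x.
  apply: comp => // b1 x ebx.
  have [q eq] : exists q, j1 b1 = ev_at j (a e) q by apply/j1P; exists b1.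
  have [q' eq'] := lift q.
  have -> : x = q'.[xe] by apply: kI; rewrite -ebx eq; exact: evk.
  by apply: compat_horner => // i; exact: coefc eq'.
exists (place k psi'); split; first split.
- by move=> c; have [x ex] := kx c; rewrite ex -(psi'K _ _ ex); exact: place_base.
- exact: placeB.
- exact: placeM.
- exact: place_neq0.
- by move=> w c; apply: place_der.
move=> w /denS[b eb]; exists (psi' b / psi' den), b, den.
by rewrite divfK.
Qed.
End Specialization.

(** * Existential closedness *)

(** [V] is an [E]-subspace of [L] containing [E], and [pi] is an [E]-linear retraction of it onto
    [E]. *)
Record retraction (E L : fieldType) (j : {rmorphism E -> L}) (V : L -> Prop) (pi : L -> E) :
    Prop := Retraction {
  retr_base : forall x, V (j x);
  retr_add : forall v w, V v -> V w -> V (v + w);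
  retr_scale : forall x v, V v -> V (j x * v);
  retr_piD : forall v w, V v -> V w -> pi (v + w) = pi v + pi w;
  retr_piZ : forall x v, V v -> pi (j x * v) = x * pi v;
  retr_pi1 : forall x, pi (j x) = x }.

(** The vectors of [s] are added one at a time; one outside the present [V] is sent to [0]. *)
Lemma ex_retraction (E L : fieldType) (j : {rmorphism E -> L}) (s : seq L) :
  exists V pi, retraction j V pi /\ forall v, v \in s -> V v.
Proof.
elim: s => [|t s [V [pi [[Vb VD VZ pD pZ p1] sV]]]].
  pose pi v := epsilon (inhabits 0) (fun x => v = j x).
  have piE x : pi (j x) = x.
    by apply/esym/(fmorph_inj j); apply: (epsilon_spec (inhabits 0) (fun y => j x = j y)); exists x.
  exists (fun v => exists x, v = j x), pi; split=> //; split=> //.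
  - by move=> x; exists x.
  - by move=> _ _ [x ->] [y ->]; exists (x + y); rewrite rmorphD.
  - by move=> x _ [y ->]; exists (x * y); rewrite rmorphM.
  - by move=> _ _ [x ->] [y ->]; rewrite -rmorphD !piE.
  - by move=> x _ [y ->]; rewrite -rmorphM !piE.
have [Vt|nVt] := classic (V t).
  by exists V, pi; split=> // v; rewrite inE => /orP[/eqP ->|/sV].
have VN v : V v -> V (- v) by move=> /(VZ (-1)); rewrite rmorphN1 mulN1r.
have uniqc v v' c c' : V v -> V v' -> v + j c * t = v' + j c' * t -> v = v'.
  move=> Vv Vv' e; have [ecc|ne] := eqVneq c c'; first by move: e; rewrite ecc => /addIr.
  have cc0 : j (c - c') != 0 by rewrite fmorph_eq0 subr_eq0.
  case: nVt; suff -> : t = j (c - c')^-1 * (v' - v).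
    by apply: VZ; apply: VD => //; exact: VN.
  rewrite fmorphV; apply: (mulfI cc0); rewrite mulrA mulfV // mul1r rmorphB mulrBl.
  by rewrite -[v'](addrK (j c' * t)) -e; ring.
pose rel v x := exists w c, [/\ V w, v = w + j c * t & x = pi w].
pose pi' v := epsilon (inhabits 0) (rel v).
have piE w c : V w -> pi' (w + j c * t) = pi w.
  move=> Vw; have [] : rel (w + j c * t) (pi' (w + j c * t)).
    by apply: (epsilon_spec (inhabits 0) (rel _)); exists (pi w), w, c.
  by move=> w' [c' [Vw' e ->]]; rewrite (uniqc w w' c c').
have V0 : V 0 by rewrite -(rmorph0 j).
exists (fun v => exists w c, V w /\ v = w + j c * t), pi'; split; first split.
- by move=> x; exists (j x), 0; rewrite rmorph0 mul0r addr0.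
- move=> _ _ [w [c [Vw ->]]] [w' [c' [Vw' ->]]]; exists (w + w'), (c + c').
  by split; [exact: VD|rewrite rmorphD mulrDl addrACA].
- move=> x _ [w [c [Vw ->]]]; exists (j x * w), (x * c).
  by split; [exact: VZ|rewrite rmorphM mulrDr mulrA].
- move=> _ _ [w [c [Vw ->]]] [w' [c' [Vw' ->]]].
  by rewrite addrACA -mulrDl -rmorphD !piE ?pD //; exact: VD.
- move=> x _ [w [c [Vw ->]]].
  by rewrite mulrDr mulrA -rmorphM !piE ?pZ //; exact: VZ.
- by move=> x; rewrite -[j x](addr0) -{1}(mul0r t) -(rmorph0 j) piE.
move=> v; rewrite inE => /orP[/eqP ->|/sV Vv].
  by exists 0, 1; rewrite rmorph1 mul1r add0r.
by exists v, 0; rewrite rmorph0 mul0r addr0.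
Qed.

(** * Subterms and preservation of formulas *)

Section Subterms.
Variables (K : Type) (L : fieldType) (d : L -> L) (h : K -> L) (env : nat -> L).

Fixpoint tsub (t : dterm K) : seq L :=
  teval d h env t ::
  match t with
  | TVar _ | TParam _ | TZero | TOne => [::]
  | TAdd t1 t2 | TMul t1 t2 => tsub t1 ++ tsub t2
  | TOpp t1 | TInv t1 | TDer t1 => tsub t1
  end.

Fixpoint fsub (phi : qfformula K) : seq L :=
  match phi with
  | FTrue | FFalse => [::]
  | FEq t1 t2 => tsub t1 ++ tsub t2
  | FNot phi1 => fsub phi1
  | FAnd phi1 phi2 | FOr phi1 phi2 => fsub phi1 ++ fsub phi2
  end.

Lemma tsub_head t : teval d h env t \in tsub t.
Proof. by case: t => *; rewrite inE eqxx. Qed.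
End Subterms.

Section Reduction.
Variables (K L : fieldType) (iota : {rmorphism K -> L}) (delta : K -> K) (dL : L -> L).
Hypotheses (hdelta : is_derivation delta) (hdL : is_derivation dL).
Hypothesis dLiota : forall x, iota (delta x) = dL (iota x).
Hypothesis sep : separable_ext iota.

(** [E = K(y)] need not be stable under [dL], so its derivation is [dL] followed by a retraction
    onto [E]. The two agree wherever [dL] already lands in [E]. *)
Lemma fg_differential_subfield (y : seq L) :
  exists (E : fieldType) (j : {rmorphism E -> L}) (kappa : {rmorphism K -> E})
    (D : E -> E) (yE : seq E), [/\ forall c, j (kappa c) = iota c, y = map j yE,
    is_derivation D, forall c, kappa (delta c) = D (kappa c) &
    [/\ forall x x', dL (j x) = j x' -> D x = x', separable_ext kappa &
    forall x, fgen (fun x => (exists c, x = kappa c) \/ x \in yE) x]].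
Proof.
pose P z := (exists c, z = iota c) \/ z \in y.
have [E [j jP]] := subfield_pack (fgen_subring P) (@fgenV _ P).
have jI : injective j := @fmorph_inj _ _ j.
have jF x : fgen P (j x) by apply/jP; exists x.
have [f fE] : exists f : K -> E, forall c, iota c = j (f c).
  by apply: (choice (fun c x => iota c = j x)) => c; apply/jP/fgen_base; left; exists c.
have [||kappa kE] := @rmorph_pack K E f.
- by move=> x x'; apply: jI; rewrite rmorphB -!fE rmorphB.
- by split=> [|x x']; apply: jI; rewrite -?fE ?rmorph1 // rmorphM -?fE rmorphM !fE.
have kappaE c : j (kappa c) = iota c by rewrite kE fE.
have [yE eyE] : exists yE, y = map j yE.
  have : forall z, z \in y -> exists x, z = j x by move=> z zy; apply/jP/fgen_base; right.
  elim: (y) => [|z s IH] hs; first by exists [::].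
  have [|sE ->] := IH; first by move=> w ws; apply: hs; rewrite inE ws orbT.
  by have [|x ->] := hs z; [rewrite inE eqxx|exists (x :: sE)].
have [V [pi [[Vb VD VZ pD pZ p1] Vy]]] := ex_retraction j (map dL y).
(* The elements of [E] that [dL] maps into [V] form a field containing [K] and [y], as [V] is an
   [E]-subspace containing [E]. *)
have VdL x : V (dL (j x)).
  suff : (exists x', j x = j x') /\ V (dL (j x)) by case.
  apply: (fgen_min (P := P) (S := fun z => (exists x', z = j x') /\ V (dL z))) (jF x) => //.
  - have VN v : V v -> V (- v) by move=> /(VZ (-1)); rewrite rmorphN1 mulN1r.
    split.
    + by split; [exists 1; rewrite rmorph1|rewrite derivation1 // -(rmorph0 j)].
    + move=> _ _ [[x1 ->] V1] [[x2 ->] V2]; split; first by exists (x1 - x2); rewrite rmorphB.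
      by rewrite hdL.1 derivationN //; apply: VD => //; exact: VN.
    + move=> _ _ [[x1 ->] V1] [[x2 ->] V2]; split; first by exists (x1 * x2); rewrite rmorphM.
      by rewrite hdL.2; apply: VD; [rewrite mulrC|]; exact: VZ.
  - move=> _ [[x1 ->] V1]; split; first by exists x1^-1; rewrite fmorphV.
    rewrite derivationV // mulNr -mulrN mulrC -rmorphXn -fmorphV -rmorphN; exact: VZ.
  - move=> z [[c ->]|zy]; split.
    + by exists (kappa c); rewrite kappaE.
    + by rewrite -dLiota -kappaE.
    + by apply/jP/fgen_base; right.
    + by apply: Vy; apply: map_f.
pose D x := pi (dL (j x)).
exists E, j, kappa, D, yE; split=> //.
- split=> x x'; rewrite /D; first by rewrite rmorphD hdL.1 pD.
  by rewrite rmorphM hdL.2 mulrC pD ?pZ //; [ring|exact: VZ|exact: VZ].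
- by move=> c; rewrite /D kappaE -dLiota -kappaE p1.
split.
- by move=> x x' e; rewrite /D e p1.
(* Linear disjointness passes to the intermediate field, whose [p]-th powers are among those of
   [L]. *)
- move=> p pK n v vK ind c hc rel i.
  apply: (jI); rewrite rmorph0; apply: (sep pK (v := j \o v) _ _ (c := j \o c)).
  + by move=> i' /=; have [x ->] := vK i'; exists x; rewrite kappaE.
  + move=> c' hc' rel' i'; have [b bE] := choice _ hc'.
    rewrite bE -kappaE -rmorphXn (ind (fun i => kappa (b i) ^+ p)) ?rmorph0 //.
      by move=> i''; exists (b i'').
    apply: jI; rewrite rmorph0 -[RHS]rel' rmorph_sum; apply: eq_bigr => l _ /=.
    by rewrite rmorphM rmorphXn /= kappaE bE.
  + by move=> i' /=; have [x ->] := hc i'; exists (j x); rewrite rmorphXn.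
  + by rewrite -[RHS](rmorph0 j) -rel rmorph_sum; apply: eq_bigr => l _; rewrite rmorphM.
move=> x; pose G := fgen (fun x => (exists c, x = kappa c) \/ x \in yE).
suff [x' /jI -> //] : exists2 x', j x = j x' & G x'.
apply: (fgen_min (P := P) (S := fun z => exists2 x', z = j x' & G x')) (jF x).
- split.
  + by exists 1; [rewrite rmorph1|exact: fgen1].
  + by move=> _ _ [x1 -> G1] [x2 -> G2]; exists (x1 - x2); [rewrite rmorphB|exact: fgenB].
  + by move=> _ _ [x1 -> G1] [x2 -> G2]; exists (x1 * x2); [rewrite rmorphM|exact: fgenM].
- by move=> _ [x1 -> G1]; exists x1^-1; [rewrite fmorphV|exact: fgenV].
move=> z [[c ->]|]; first by exists (kappa c) => //; apply: fgen_base; left; exists c.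
by rewrite eyE => /mapP[x1 x1y ->]; exists x1 => //; apply: fgen_base; right.
Qed.

Hypothesis solv : diff_solvable delta.

(** All subterm values lie in [E], and a differential place defined on enough elements carries them
    to [K], preserving both equality and inequality of terms. *)
Lemma solvable_existentially_closed : existentially_closed_in delta dL iota.
Proof.
move=> phi [env holds]; pose y := fsub dL iota env phi.
have [E [j [kappa [D [yE [kappaE ey hD Dk [Dj sepk gen]]]]]]] := fg_differential_subfield y.
have jI : injective j := @fmorph_inj _ _ j.
(* A value for an inverse forces a nonzero value for the element; the differences are included to
   separate distinct subterms. *)
pose S := yE ++ map (fun x => x^-1) yE ++ [seq (x1 - x2)^-1 | x1 <- yE, x2 <- yE].
have [R [[Rb RB RM Rn0 RD] RS]] := specialization hdelta solv hD Dk sepk gen S.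
have R0 : R 0 0 by rewrite -{1}(rmorph0 kappa).
have R1 : R 1 1 by rewrite -{1}(rmorph1 kappa).
have RN z c : R z c -> R (- z) (- c) by move=> /(RB _ _ _ _ R0); rewrite !sub0r.
have R_D z z' c c' : R z c -> R z' c' -> R (z + z') (c + c').
  by move=> h /RN /(RB _ _ _ _ h); rewrite !opprK.
have Rz c : R 0 c -> c = 0.
  by move=> h; apply/eqP/negPn/negP => /(Rn0 _ _ h); rewrite eqxx.
have Rfun z c c' : R z c -> R z c' -> c = c'.
  by move=> h h'; apply/eqP; rewrite -subr_eq0; apply/eqP/Rz; rewrite -(subrr z); exact: RB.
have jy z : z \in y -> exists2 x, z = j x & x \in yE.
  by rewrite ey => /mapP[x xy ->]; exists x.
pose env' i := epsilon (inhabits 0) (fun c => exists2 x, env i = j x & R x c).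
exists env'.
have teE t : {subset tsub dL iota env t <= y} ->
    exists2 x, teval dL iota env t = j x & R x (teval delta idfun env' t).
  elim: t => [i|c|||t1 IH1 t2 IH2|t1 IH1|t1 IH1 t2 IH2|t1 IH1|t1 IH1] /= sub.
  - have [x ex xy] : exists2 x, env i = j x & x \in yE by apply/jy/sub; rewrite inE.
    have [c Rc] : exists c, R x c by apply: RS; rewrite mem_cat xy.
    apply: (epsilon_spec (inhabits 0) (fun c => exists2 x, env i = j x & R x c)).
    by exists c, x.
  - by exists (kappa c).
  - by exists 0; rewrite ?rmorph0.
  - by exists 1; rewrite ?rmorph1.
  - have [|x1 -> Rx1] := IH1; first by move=> z z1; apply: sub; rewrite inE mem_cat z1 orbT.
    have [|x2 -> Rx2] := IH2; first by move=> z z1; apply: sub; rewrite inE mem_cat z1 !orbT.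
    by exists (x1 + x2); [rewrite rmorphD|exact: R_D].
  - have [|x1 -> Rx1] := IH1; first by move=> z z1; apply: sub; rewrite inE z1 orbT.
    by exists (- x1); [rewrite rmorphN|exact: RN].
  - have [|x1 -> Rx1] := IH1; first by move=> z z1; apply: sub; rewrite inE mem_cat z1 orbT.
    have [|x2 -> Rx2] := IH2; first by move=> z z1; apply: sub; rewrite inE mem_cat z1 !orbT.
    by exists (x1 * x2); [rewrite rmorphM|exact: RM].
  - have [|x1 e1 Rx1] := IH1; first by move=> z z1; apply: sub; rewrite inE z1 orbT.
    exists x1^-1; first by rewrite e1 fmorphV.
    have x1y : x1 \in yE.
      have [x e x_y] : exists2 x, teval dL iota env t1 = j x & x \in yE.
        by apply/jy/sub; rewrite inE tsub_head orbT.
      by rewrite (jI x1 x) // -e1.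
    (* For [x1 = 0] both inverses are [0] by convention. Otherwise the value of [x1^-1] must be
       inverse to that of [x1]. *)
    have [x10|x10] := eqVneq x1 0.
      by rewrite x10 in Rx1 *; rewrite (Rz _ Rx1) !invr0.
    have [c' Rc'] : exists c, R x1^-1 c.
      by apply: RS; rewrite !mem_cat map_f ?orbT.
    have cc : teval delta idfun env' t1 * c' = 1.
      by apply: (Rfun 1) => //; rewrite -(mulfV x10); exact: RM.
    suff -> : (teval delta idfun env' t1)^-1 = c' by [].
    have c0 : teval delta idfun env' t1 != 0.
      by apply: contra_eq_neq cc => ->; rewrite mul0r eq_sym oner_neq0.
    by apply: (mulfI c0); rewrite mulfV.
  - have [|x1 e1 Rx1] := IH1; first by move=> z z1; apply: sub; rewrite inE z1 orbT.
    exists (D x1); last exact: RD.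
    have [x e x_y] : exists2 x, dL (teval dL iota env t1) = j x & x \in yE.
      by apply/jy/sub; rewrite inE eqxx.
    by rewrite e (Dj x1 x) // -e1.
have teq t1 t2 : {subset tsub dL iota env t1 <= y} -> {subset tsub dL iota env t2 <= y} ->
    teval dL iota env t1 = teval dL iota env t2 <->
    teval delta idfun env' t1 = teval delta idfun env' t2.
  move=> s1 s2; have [x1 e1 Rx1] := teE t1 s1; have [x2 e2 Rx2] := teE t2 s2.
  rewrite e1 e2; split=> [/jI ex|ec]; first by apply: (Rfun x1) => //; rewrite ex.
  apply: (congr1 j); apply/eqP/negPn/negP; rewrite -subr_eq0 => ne.
  have inE' x t : teval dL iota env t = j x -> {subset tsub dL iota env t <= y} -> x \in yE.
    by move=> et st; have [x' e' xy] := jy _ (st _ (tsub_head _ _ _ t)); rewrite (jI x x') // -et.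
  (* With equal values of [x1] and [x2], the product of [x1 - x2] with its inverse would give [1]
     the value [0]. *)
  have [c' Rc'] : exists c, R (x1 - x2)^-1 c.
    apply: RS; rewrite !mem_cat; apply/orP; right; apply/orP; right.
    by apply: (allpairs_f (fun a b => (a - b)^-1)); [exact: inE' e1 s1|exact: inE' e2 s2].
  have := RM _ _ _ _ (RB _ _ _ _ Rx1 Rx2) Rc'; rewrite mulfV // ec subrr mul0r => R10.
  by have /eqP := Rfun _ _ _ R1 R10; rewrite oner_eq0.
have main psi : {subset fsub dL iota env psi <= y} ->
    (qfholds dL iota env psi <-> qfholds delta idfun env' psi).
  elim: psi => //= [t1 t2|f1 IH1|f1 IH1 f2 IH2|f1 IH1 f2 IH2] sub.
  - by apply: teq => z zs; apply: sub; rewrite mem_cat zs ?orbT.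
  - by have [h h'] := IH1 sub; split=> n hn; apply: n; auto.
  - have [|h1 h1'] := IH1; first by move=> z zs; apply: sub; rewrite mem_cat zs.
    have [|h2 h2'] := IH2; first by move=> z zs; apply: sub; rewrite mem_cat zs orbT.
    by split=> -[]; split; auto.
  - have [|h1 h1'] := IH1; first by move=> z zs; apply: sub; rewrite mem_cat zs.
    have [|h2 h2'] := IH2; first by move=> z zs; apply: sub; rewrite mem_cat zs orbT.
    by split=> -[]; auto.
by have [h _] := main phi (fun _ => id); exact: h.
Qed.
End Reduction.

(** * Separable extensions *)

Lemma fraction_frac_of (R : idomainType) (x : {fraction R}) :
  frac_of (@FracField.tofrac R) x.
Proof.
elim/quotW: x => r; exists \n_r, \d_r.
have d0 : \d_r != 0 := denom_ratioP r.
have dF0 : FracField.tofrac \d_r != 0 by rewrite tofrac_eq0.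
split=> //; apply: (canRL (mulfK dF0)).
rewrite -[LHS]/(FracField.mul (\pi%qT r) (FracField.tofrac \d_r)) !piE.
apply/eqP; rewrite piE /= FracField.equivfE /FracField.mulf !numden_Ratio ?oner_neq0 ?mulr1 //.
by rewrite mulrC.
Qed.

Lemma adjoin_transcendental (F : fieldType) : exists (F' : fieldType) (j : {rmorphism F -> F'}) (t : F'),
  (forall q, ev_at j t q = 0 -> q = 0) /\ forall x, frac_of (ev_at j t) x.
Proof.
pose f : {rmorphism {poly F} -> {fraction {poly F}}} := @FracField.tofrac _.
exists {fraction {poly F}}, (f \o polyC), (f 'X).
have evE q : ev_at (f \o polyC) (f 'X) q = f q.
  rewrite /ev_at map_poly_comp horner_map /=; congr (f _).
  by rewrite -[LHS]/(q \Po 'X) comp_polyXr.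
split=> [q|x]; first by rewrite evE => /eqP; rewrite tofrac_eq0 => /eqP.
have [a [b [b0 ->]]] := fraction_frac_of x.
by exists a, b; rewrite !evE.
Qed.

(** A family from [K] independent over [p]-th powers of [K] stays so over those of [F], then over
    those of [L]. *)
Lemma separable_ext_comp (K F L : fieldType) (iota : {rmorphism K -> F}) (j : {rmorphism F -> L}) :
  separable_ext iota -> separable_ext j -> separable_ext (j \o iota).
Proof.
move=> sepi sepj p pK n v vK ind.
have pF : p \in [pchar F] by rewrite (fmorph_pchar iota).
have jI : injective j := @fmorph_inj _ _ j.
have [c cE] := choice _ vK.
have ind1 : linearly_independent_over (fun z => exists x : K, z = iota x ^+ p) (iota \o c).
  move=> b hb rel i; have [d dE] := choice _ hb.
  apply: (jI); rewrite rmorph0; apply: (ind (j \o b)).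
    by move=> k /=; exists (d k); rewrite dE rmorphXn.
  rewrite -[RHS](rmorph0 j) -rel rmorph_sum; apply: eq_bigr => k _ /=.
  by rewrite rmorphM cE.
have ind2 := sepi p pK n _ (fun i => ex_intro _ (c i) erefl) ind1.
apply: (sepj p pF) => [i|]; first by exists (iota (c i)); rewrite cE.
move=> b hb rel i; have [d dE] := choice _ hb.
have := ind2 (fun i => d i ^+ p) (fun i => ex_intro _ (d i) erefl) _ i.
rewrite dE -rmorphXn => ->; rewrite ?rmorph0 //.
apply: (jI); rewrite rmorph0 -[RHS]rel rmorph_sum; apply: eq_bigr => k _ /=.
by rewrite rmorphM rmorphXn cE dE.
Qed.

Lemma poly_expp_coef (F : fieldType) p (q : {poly F}) k : p \in [pchar F] ->
  (q ^+ p)`_(k * p) = q`_k ^+ p.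
Proof.
move=> pF; have pP : p \in [pchar {poly F}] by rewrite (fmorph_pchar polyC).
have p0 : (0 < p)%N by apply: prime_gt0; exact: pcharf_prime pF.
rewrite -{1}[q]coefK poly_def -(pFrobenius_autE pP) rmorph_sum /= coef_sum.
under eq_bigr do rewrite pFrobenius_autE -mul_polyC exprMn -polyC_exp -exprM coefCM coefXn eqn_pmul2r //.
have [lt|ge] := ltnP k (size q).
  rewrite (bigD1 (Ordinal lt)) //= eqxx mulr1 big1 ?addr0 // => i ik.
  by rewrite eq_sym -[k]/(val (Ordinal lt)) (inj_eq val_inj) (negPf ik) mulr0.
rewrite nth_default // expr0n (gtn_eqF p0) big1 // => i _.
by rewrite (gtn_eqF (leq_trans (ltn_ord i) ge)) mulr0.
Qed.

(** After clearing denominators a relation becomes [sum N_i^p w_i = 0] in [F[X]]; its coefficients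
    at [X^(kp)] are relations over the [p]-th powers of [F]. *)
Lemma separable_transcendental (F F' : fieldType) (j : {rmorphism F -> F'}) t :
  (forall q, ev_at j t q = 0 -> q = 0) -> (forall x, frac_of (ev_at j t) x) ->
  separable_ext j.
Proof.
move=> tr fr p pF n v vF ind b hb rel.
have [w wE] := choice _ vF; have [d dE] := choice _ hb.
have evI : injective (ev_at j t).
  by move=> q r e; apply/eqP; rewrite -subr_eq0; apply/eqP/tr; rewrite rmorphB /= e subrr.
have [x _|a a0 ha] := @frac_of_common _ _ (ev_at j t) (codom d) evI; first exact: fr.
have /choice[N NE] : forall i, exists q, d i * ev_at j t a = ev_at j t q.
  by move=> i; apply: ha; exact: codom_f.
have relN : \sum_i N i ^+ p * (w i)%:P = 0.
  apply: evI; rewrite rmorph_sum rmorph0 /=.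
  transitivity (ev_at j t a ^+ p * \sum_i b i * v i); last by rewrite rel mulr0.
  rewrite mulr_sumr.
  apply: eq_bigr => i _; rewrite rmorphM rmorphXn /= ev_atC -NE exprMn wE dE.
  by ring.
have jI : injective j := @fmorph_inj _ _ j.
have Nk k i : (N i)`_k ^+ p = 0.
  apply: (jI); rewrite rmorph0 rmorphXn.
  apply: (ind (fun i => j (N i)`_k ^+ p)) => [i'|]; first by exists (N i')`_k.
  transitivity (j (\sum_i N i ^+ p * (w i)%:P)`_(k * p)); last by rewrite relN coef0 rmorph0.
  rewrite coef_sum rmorph_sum.
  by apply: eq_bigr => i' _; rewrite coefMC poly_expp_coef // rmorphM rmorphXn wE.
have p0 : (0 < p)%N by apply: prime_gt0; exact: pcharf_prime pF.
move=> i; have N0 : N i = 0.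
  by apply/polyP => k; rewrite coef0; move/eqP: (Nk k i); rewrite expf_eq0 p0 => /eqP.
have ea0 : ev_at j t a != 0 by rewrite -(rmorph0 (ev_at j t)) (inj_eq evI).
have := NE i; rewrite N0 rmorph0 => /eqP; rewrite mulf_eq0 (negPf ea0) orbF => /eqP di.
by rewrite dE di expr0n (gtn_eqF p0).
Qed.

(** The powers of [z^p] below the degree of [z] are independent over [F], so a relation over [p]-th
    powers of [L] splits into relations over those of [F]. *)
Lemma separable_simple (F : fieldType) (L : fieldExtType F) (z : L) (h : {poly F}) :
  separable_poly h -> root (map_poly (in_alg L) h) z -> <<1; z>>%VS = fullv ->
  separable_ext (in_alg L : {rmorphism F -> L}).
Proof.
move=> sh hz full p pF n v vF ind b hb rel.
have [j jE] : exists j : {rmorphism F -> L}, forall x, in_alg L x = j x by exists (in_alg L).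
have mapE q : map_poly (in_alg L) q = map_poly j q by exact: eq_map_poly.
have [w wE] := choice _ vF; have [d dE] := choice _ hb.
have pL : p \in [pchar L] by rewrite (fmorph_pchar (in_alg L)).
have pp : prime p := pcharf_prime pF.
have p0 : (0 < p)%N := prime_gt0 pp.
have sz : separable_element 1 z.
  apply/separable_elementP; exists (map_poly (in_alg L) h); split=> //.
    by apply/polyOver1P; exists h.
  by rewrite separable_map.
(* Separability of [z] gives [F(z^p) = F(z)], so both generators have the same degree. *)
have fullp : <<1; z ^+ p>>%VS = fullv.
  apply/eqP; rewrite eqEsubv subvf /= -full; apply/FadjoinP; split; first exact: sub1v.
  by have := sz; rewrite (pcharf_p_separable 1%AS z 0 pL) expn1.
have degE : adjoin_degree 1%AS (z ^+ p) = adjoin_degree 1%AS z.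
  by rewrite !adjoin_degreeE /= full fullp.
have hQ i : exists q : {poly F}, d i = ev_at j z q /\
    (size q <= adjoin_degree 1%AS z)%N.
  have dz : d i \in <<1; z>>%VS by rewrite full memvf.
  have /polyOver1P[q eq] := Fadjoin_polyOver 1%VS z (d i).
  exists q; rewrite /ev_at -mapE -eq (Fadjoin_poly_eq (K := 1%AS)) //; split=> //.
  by have := size_Fadjoin_poly 1%VS z (d i); rewrite eq size_map_poly.
have [q qE] := choice _ hQ.
(* [N(z^p)] is the given relation with each [d_i^p] expanded by Frobenius. *)
pose N : {poly F} := \poly_(k < adjoin_degree 1%AS z) (\sum_i (q i)`_k ^+ p * w i).
have N0 : map_poly j N = 0.
  apply/eqP; rewrite -(@root_small_adjoin_poly _ _ 1%AS (z ^+ p)); last 2 first.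
  - by rewrite -mapE; apply/polyOver1P; exists N.
  - by rewrite degE size_map_poly; exact: size_poly.
  apply/rootP; rewrite -[RHS]rel (@horner_coef_wide _ (adjoin_degree 1%AS z)); last first.
    by rewrite size_map_poly; exact: size_poly.
  transitivity (\sum_i \sum_(k < adjoin_degree 1%AS z)
      (j (q i)`_k * z ^+ k) ^+ p * j (w i)).
    rewrite exchange_big; apply: eq_bigr => k _ /=.
    rewrite coef_map /= coef_poly ltn_ord rmorph_sum mulr_suml; apply: eq_bigr => i _ /=.
    by rewrite rmorphM rmorphXn exprMn -exprM mulnC exprM mulrAC.
  apply: eq_bigr => i _; rewrite -mulr_suml dE wE -jE (qE i).1; congr (_ * _).
  rewrite /ev_at (@horner_coef_wide _ (adjoin_degree 1%AS z)); last first.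
    by rewrite size_map_poly; exact: (qE i).2.
  rewrite -(pFrobenius_autE pL) rmorph_sum; apply: eq_bigr => k _ /=.
  by rewrite pFrobenius_autE coef_map.
have jI : injective j := @fmorph_inj _ _ j.
have Nk k i : (q i)`_k ^+ p = 0.
  have [lt|ge] := ltnP k (adjoin_degree 1%AS z); last first.
    by rewrite nth_default ?expr0n ?(gtn_eqF p0) //; exact: leq_trans (qE i).2 ge.
  apply: (jI); rewrite rmorph0 rmorphXn.
  apply: (ind (fun i => j (q i)`_k ^+ p)) => [i'|]; first by exists (q i')`_k; rewrite -jE.
  transitivity (map_poly j N)`_k; last by rewrite N0 coef0.
  rewrite coef_map /= coef_poly lt rmorph_sum; apply: eq_bigr => i' _ /=.
  by rewrite rmorphM rmorphXn wE -!jE.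
move=> i; have q0 : q i = 0.
  by apply/polyP => k; rewrite coef0; move/eqP: (Nk k i); rewrite expf_eq0 p0 => /eqP.
by rewrite dE (qE i).1 q0 rmorph0 expr0n (gtn_eqF p0).
Qed.

(** A divisor [h] of least size with nonzero derivative is irreducible, and its gcd with [h'] is
    then trivial for degree reasons. *)
Lemma ex_irreducible_sep (F : fieldType) (q : {poly F}) : q^`() != 0 ->
  exists h : {poly F}, [/\ irreducible_poly h, h %| q & separable_poly h].
Proof.
move=> q'0.
have [n [h [hq h'0 sh]] min] := ex_minP (ex_intro (fun n => exists h : {poly F},
  [/\ h %| q, h^`() != 0 & size h = n]) _ (ex_intro _ q (And3 (dvdpp q) q'0 erefl))).
have h0 : h != 0 by apply: contraNneq h'0 => ->; rewrite deriv0.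
have sh1 : (1 < size h)%N.
  rewrite ltnNge; apply: contraNN h'0 => /size1_polyC ->; by rewrite derivC.
have irr : irreducible_poly h.
  split=> // r sr rh; have [s es] := dvdpP _ _ rh.
  have s0 : s != 0 by apply: contraNneq h0 => s0; rewrite es s0 mul0r.
  have r0 : r != 0 by apply: contraNneq h0 => r0; rewrite es r0 mulr0.
  have sz : size h = (size s + size r).-1 by rewrite es size_mul.
  (* If [r' <> 0], minimality gives [r] the size of [h]. If [r' = 0], the cofactor [s] is a smaller
     divisor with nonzero derivative. *)
  have [r'0|r'0] := eqVneq r^`() 0; last first.
    rewrite -dvdp_size_eqp // eqn_leq dvdp_leq //= sh; apply: min.
    by exists r; split=> //; exact: dvdp_trans rh hq.
  have s'0 : s^`() != 0.
    by apply: contraNneq h'0 => s'0; rewrite es derivM s'0 r'0 mul0r mulr0 addr0.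
  have sh' : s %| h by apply/dvdpP; exists r; rewrite mulrC.
  have := min (size s) (ex_intro _ s (And3 (dvdp_trans sh' hq) s'0 erefl)).
  rewrite -sh sz; have := size_poly_gt0 r; have := size_poly_gt0 s; rewrite r0 s0 => gs gr le.
  by move/eqP: sr; case; move: gs gr le; lia.
exists h; split=> //; rewrite separable_poly.unlock /coprimep; apply/negPn/negP => ne.
have := irr.2 _ ne (dvdp_gcdl _ _) => e; have := dvdp_gcdr h h^`().
rewrite (eqp_dvdl _ e) => /(dvdp_leq h'0); rewrite leqNgt lt_size_deriv //.
Qed.

(** * Generic solutions *)

(** Abstracts [K(x_0, ..., x_(n-1))]. Derivations take values in an extension [L], since the last
    derivative is to be the adjoined root. *)
Record generic_field (K : fieldType) (n : nat) (F : fieldType) (iota : {rmorphism K -> F})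
    (x : nat -> F) : Prop := GenericField {
  generic_indep : forall Q, vars_lt n Q -> pev iota x Q = 0 -> Q = 0;
  generic_sep : separable_ext iota;
  generic_der : forall (L : fieldType) (j : {rmorphism F -> L}) (d0 : K -> L) (c : nat -> L),
    der_along (j \o iota) d0 ->
    exists d : F -> L, [/\ der_along j d, forall a, d (iota a) = d0 a &
      forall i, (i < n)%N -> d (x i) = c i] }.

Lemma pev_dX (K : fieldType) (Q : dpoly K) : pev malgC dX Q = Q.
Proof. by apply/esym; apply: (pev_unique (phi := idfun)). Qed.

Lemma ex_generic_field (K : fieldType) n :
  exists (F : fieldType) (iota : {rmorphism K -> F}) x, generic_field n iota x.
Proof.
elim: n => [|n [F [iota [x [indep sep der]]]]].
  exists K, idfun, (fun=> 0); split.
  (* No variable occurs in [Q], so evaluation at zero, carried back along [malgC], recovers [Q]. *)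
  - move=> Q vQ Q0; rewrite -(pev_dX Q).
    rewrite (@eq_pev _ _ _ _ (fun=> 0)); last by case: vQ => vQ j /vQ.
    have e := rmorph_pev (iota := idfun) (h := malgC : {rmorphism K -> dpoly K})
      (kappa := malgC) (fun=> 0) Q (fun=> erefl).
    rewrite Q0 in e; transitivity (malgC 0 : dpoly K); last exact: malgC0E.
    by apply: (etrans _ (esym e)); apply: eq_pev => j _; exact: (esym malgC0E).
  - by move=> p pK k v vK ind b hb; apply: ind => i; have [y ->] := hb i; exists y.
  - by move=> L j d0 c hd; exists d0.
have [F' [j [t [tr fr]]]] := adjoin_transcendental F.
pose x' i := if (i < n)%N then j (x i) else t.
have x'E Q : vars_lt n Q -> pev (j \o iota) x' Q = j (pev iota x Q).
  move=> [vQ]; rewrite (rmorph_pev (h := j) (kappa := j \o iota)) //.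
  by apply: eq_pev => i /vQ lt; rewrite /x' lt.
exists F', (j \o iota), x'; split.
- move=> Q vQ; rewrite (pev_dsplit _ _ n) {2}/x' ltnn => e0.
  have vc i := dsplit_vars i vQ.
  have e1 : ev_at j t (map_poly (pev iota x) (dsplit n Q)) = 0.
    rewrite -[RHS]e0; congr (_.[_]); apply/polyP => i.
    by rewrite !coef_map /= x'E.
  have s0 : dsplit n Q = 0.
    apply/polyP => i; rewrite coef0; apply: indep (vc i) _.
    by have := congr1 (fun q : {poly F} => q`_i) (tr _ e1); rewrite coef_map coef0.
  by rewrite -(dsplitK n Q) s0 horner0.
- by apply: separable_ext_comp => //; exact: separable_transcendental fr.
move=> L k d0 c hd.
have [d1 [hd1 d1i d1x]] := der L (k \o j) d0 c hd.
have evk q : ev_at (k \o j) (k t) q = k (ev_at j t q).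
  by rewrite /ev_at map_poly_comp horner_map.
have [|d [hd' dE dt]] := ext_simple hd1 (t := k t) (c := c n).
  move=> q; rewrite evk => /eqP; rewrite fmorph_eq0 => /eqP /tr ->.
  exact: (der_along0 (polyder_at_along hd1 _ _)).
have frk z : frac_of (ev_at (k \o j) (k t)) (k z).
  have [a [b [b0 ->]]] := fr z; exists a, b; rewrite !evk fmorph_eq0 b0.
  by rewrite rmorphM fmorphV.
exists (d \o k); split.
- by split=> z z'; rewrite /= ?rmorphD ?rmorphM; [rewrite hd'.1|rewrite hd'.2].
- by move=> a; rewrite -d1i -dE.
move=> i; rewrite ltnS leq_eqVlt /x' /= => /orP[/eqP ->|lt].
  by rewrite ltnn dt.
by rewrite lt -d1x // -dE.
Qed.

(** One term serves all differential fields over [K], as it is read both in the extension and in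
    [K]. *)
Lemma ex_dterm (K : fieldType) (P : dpoly K) : exists t : dterm K,
  forall (L : fieldType) (d : L -> L) (h : {rmorphism K -> L}) env,
    teval d h env t = pev h (jet d (env 0%N)) P.
Proof.
apply: (dpoly_ind (G := fun P => exists t : dterm K,
  forall (L : fieldType) (d : L -> L) (h : {rmorphism K -> L}) env,
    teval d h env t = pev h (jet d (env 0%N)) P)) P.
- by move=> c; exists (TParam c) => L d h env; rewrite pevC.
- by move=> P Q [t tE] [s sE]; exists (TAdd t s) => L d h env; rewrite rmorphD /= tE sE.
- by move=> P Q [t tE] [s sE]; exists (TMul t s) => L d h env; rewrite rmorphM /= tE sE.
- move=> j; exists (iter j (@TDer K) (TVar K 0)) => L d h env; rewrite pevX /jet.
  by elim: j => //= j ->.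
Qed.

Lemma sdc_diff_solvable (K : fieldType) (delta : K -> K) : is_derivation delta ->
  separably_diff_closed delta -> diff_solvable delta.
Proof.
move=> hdelta sdc f g _ g0 _ sf hg.
pose n := dord f; have vf : vars_lt n.+1 f := vars_lt_dord f.
have vg : vars_lt n g.
  by constructor=> j jg; rewrite ltnNge; apply/negP => /hg; rewrite jg.
have [F [iota [x [indep sep der]]]] := ex_generic_field K n.
(* [f] as a polynomial in [x_n] over [F]; its derivative is nonzero by independence and the separant
   hypothesis. *)
pose q := map_poly (pev iota x) (dsplit n f).
have vc i := dsplit_vars i vf.
have q'0 : q^`() != 0.
  apply/eqP => q'0; apply: sf; rewrite /separant dpartial_dsplit.
  suff -> : (dsplit n f)^`() = 0 by rewrite horner0.
  apply/polyP => i; rewrite coef0; apply: indep.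
    rewrite coef_deriv; move: (_`_i.+1) (vc i.+1) => c vcc.
    elim: (i.+1) => [|m IH]; first by rewrite mulr0n; exact: vars_lt0.
    by rewrite mulrS; exact: vars_ltD.
  have := congr1 (fun r : {poly F} => r`_i) q'0.
  by rewrite /q deriv_map coef_map coef0.
have [h [irr hq sh]] := ex_irreducible_sep q'0.
have [L _ [z hz full]] := irredp_FAdjoin irr.
have sepj := separable_simple sh hz full.
have [j [jE sepjj]] : exists j : {rmorphism F -> L}, in_alg L =1 j /\ separable_ext j.
  by exists (in_alg L).
have mapE r : map_poly (in_alg L) r = map_poly j r by exact: eq_map_poly.
have hz0 : ev_at j z h = 0 by rewrite /ev_at -mapE; exact/rootP.
have h'z : ev_at j z h^`() != 0.
  apply/eqP => h'z; move: sh; rewrite separable_poly.unlock => /Bezout_eq1_coprimepP[u].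
  move/(congr1 (ev_at j z)); rewrite rmorphD !rmorphM rmorph1 /= hz0 h'z !mulr0 addr0.
  by move/esym/eqP; rewrite oner_eq0.
have allev w : exists r, w = ev_at j z r.
  have : w \in <<1; z>>%VS by rewrite full memvf.
  case/(Fadjoin_polyP (K := 1%AS)) => r /polyOver1P[r' ->] ->.
  by exists r'; rewrite /ev_at mapE.
(* The jet of the intended solution [X 0], ending in [X n = z]; for [n = 0] the solution is [z]
   itself. *)
pose X i : L := if (i < n)%N then j (x i) else z.
have hd0 : der_along (j \o iota) (j \o iota \o delta).
  by split=> a b; rewrite /= ?hdelta.1 ?hdelta.2 !(rmorphD, rmorphM).
have [d1 [hd1 d1i d1x]] := der L j _ (fun i => X i.+1) hd0.
(* The derivative of [z] is whatever its separable equation forces; only the jet up to order [n]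
   matters for [f]. *)
have [_ [D [hD' DE _]]] := ext_sep hd1 hz0 h'z.
have fr w : frac_of (ev_at j z) w.
  by have [r ->] := allev w; exact: frac_of_ev.
have hD : is_derivation D by split=> a b; [apply: hD'.1|apply: hD'.2].
have DX i : (i < n)%N -> D (X i) = X i.+1.
  by move=> lt; rewrite {1}/X lt DE d1x.
have jetX i : (i <= n)%N -> jet D (X 0%N) i = X i.
  by elim: i => //= i IH lt; rewrite /jet /= -/(jet D (X 0%N) i) IH ?DX // ltnW.
have XE Q : vars_lt n Q -> pev (j \o iota) X Q = j (pev iota x Q).
  move=> [vQ]; rewrite (rmorph_pev (h := j) (kappa := j \o iota)) //.
  by apply: eq_pev => i /vQ lt; rewrite /X lt.
have [tf tfE] := ex_dterm f; have [tg tgE] := ex_dterm g.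
have Diota a : (j \o iota) (delta a) = D ((j \o iota) a) by rewrite /= DE d1i.
have [|env] := sdc L D (j \o iota) hD Diota (separable_ext_comp sep sepjj)
    (FAnd (FEq tf (TZero K)) (FNot (FEq tg (TZero K)))).
  exists (fun=> X 0%N); split=> /=.
    rewrite tfE (@eq_pev _ _ _ _ X); last by case: vf => vf' i /vf' lt; apply: jetX.
    rewrite (pev_dsplit _ _ n) {2}/X ltnn.
    have -> : map_poly (pev (j \o iota) X) (dsplit n f) = map_poly j q.
      by apply/polyP => i; rewrite !coef_map /= XE.
    have [r er] := dvdpP _ _ hq; rewrite -/(ev_at j z q) er.
    by rewrite rmorphM /= hz0 mulr0.
  rewrite tgE (@eq_pev _ _ _ _ X); last by case: vg => vg' i /vg' lt; apply: jetX; exact: ltnW.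
  by rewrite XE // => /eqP; rewrite fmorph_eq0 => /eqP /(indep _ vg).
rewrite /= => -[ef eg]; exists (env 0%N); rewrite !deval_pev.
have tfK := tfE K delta idfun env; have tgK := tgE K delta idfun env.
by rewrite tfK in ef; rewrite tgK in eg.
Qed.

Theorem theorem4p3 (K : fieldType) (delta : K -> K)
    (hdelta : is_derivation delta) :
  separably_diff_closed delta <->
  (forall f g : dpoly K,
     f <> 0 -> g <> 0 -> ~ in_base f -> separant f <> 0 ->
     (forall j : nat, (dord f <= j)%N -> ~~ doccurs j g) ->
     exists a : K, deval delta f a = 0 /\ deval delta g a <> 0).
Proof.
split=> [|solv]; first exact: sdc_diff_solvable.
by move=> L dL iota hdL dLiota sep; exact: solvable_existentially_closed.
Qed.
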